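(* Let $\mathcal{T}$ be the family of Poncelet triangles inscribed in the ellipse $\mathcal{E}$ and circumscribing the nested ellipse $\mathcal{E}_c$, and let $P$ be a fixed point. Then the locus $\mathcal{L}_{gP}$ of the isogonal conjugate $gP$ of $P$ with respect to the triangles in $\mathcal{T}$ is a conic.
   Context: $\mathcal{E}$ is a generic ellipse with semiaxes' lengths $a,b$, given by $(x/a)^2+(y/b)^2=1$. $\mathcal{E}_c$ is an ellipse nested in $\mathcal{E}$ such that the pair admits a Poncelet porism of triangles, and $\mathcal{T}$ is the resulting one-parameter family of triangles inscribed in $\mathcal{E}$ with sides tangent to $\mathcal{E}_c$. The isogonal conjugate $gP$ of a point $P$ with respect to a triangle is the point of concurrence of the cevians of $P$ (lines from each vertex through $P$) reflected about the angle bisectors; if $P$ has barycentric coordinates $[z_1:z_2:z_3]$ and the triangle has sidelengths $l_1,l_2,l_3$, then $gP=[l_1^2/z_1:l_2^2/z_2:l_3^2/z_3]$. Isogonal conjugation sends a triangle's circumcircle to the line at infinity. ''Conic'' means a curve of degree at most two, degenerate cases included (for instance, the locus degenerates to a line minus a point if $P$ is on $\mathcal{E}$, and is a single stationary point if $P$ is a focus of $\mathcal{E}_c$). *)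

(* Defs.v *)
(* The real numbers are an arbitrary [R : realType]. *)
From mathcomp Require Import all_boot all_order all_algebra.
From mathcomp Require Import classical_sets reals.

Set Implicit Arguments.
Unset Strict Implicit.
Unset Printing Implicit Defensive.

Import Order.TTheory GRing.Theory Num.Theory.
Local Open Scope classical_set_scope.
Local Open Scope ring_scope.

Section Plane.
Variable R : realType.

Definition abscissa (X : 'rV[R]_2) : R := X 0 0.
Definition ordinate (X : 'rV[R]_2) : R := X 0 1.

Definition dot (u v : 'rV[R]_2) : R := (u *m v^T) 0 0.

(* The Euclidean norm; the norm [`|v|] that MathComp-Analysis puts on matrices
   is the sup norm. *)
Definition enorm (v : 'rV[R]_2) : R := Num.sqrt (dot v v).

Definition perp (u : 'rV[R]_2) : 'rV[R]_2 :=
  \row_(j < 2) (if j == 0 then - ordinate u else abscissa u).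

Definition line (A B : 'rV[R]_2) : set 'rV[R]_2 :=
  [set X | exists t : R, X = A + t *: (B - A)].

Definition ellipse (a b : R) : set 'rV[R]_2 :=
  [set X | (abscissa X / a) ^+ 2 + (ordinate X / b) ^+ 2 = 1].

Definition ellipse_interior (a b : R) : set 'rV[R]_2 :=
  [set X | (abscissa X / a) ^+ 2 + (ordinate X / b) ^+ 2 < 1].

(* An ellipse in arbitrary position: [O] is the center, and for a unit vector
   [u] the semiaxes have lengths [p] (along [u]) and [q] (along [perp u]). *)
Definition ellipse_at (O u : 'rV[R]_2) (p q : R) : set 'rV[R]_2 :=
  [set X | (dot (X - O) u / p) ^+ 2 + (dot (X - O) (perp u) / q) ^+ 2 = 1].

Definition triangle (A B C : 'rV[R]_2) : Prop := A <> B /\ ~ line A B C.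

(* This is tangency when [A <> B] and [K] is an ellipse. *)
Definition tangent (A B : 'rV[R]_2) (K : set 'rV[R]_2) : Prop :=
  exists! X, line A B X /\ K X.

Definition poncelet_triangle (E Ec : set 'rV[R]_2) (A B C : 'rV[R]_2) : Prop :=
  [/\ triangle A B C,
      [/\ E A, E B & E C] &
      [/\ tangent B C Ec, tangent C A Ec & tangent A B Ec]].

Definition triangle_porism (E Ec : set 'rV[R]_2) : Prop :=
  forall A, E A -> exists B C, poncelet_triangle E Ec A B C.

(* Points of the real projective plane are represented by their homogeneous
   coordinates [x : y : w], i.e. by nonzero vectors of ['rV[R]_(2 + 1)]; the
   line at infinity is w = 0, and a set of projective points is a set of
   nonzero vectors stable under nonzero scaling. *)
Definition affine_point (X : 'rV[R]_2) : 'rV[R]_(2 + 1) := row_mx X 1%:M.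
Definition infinite_point (d : 'rV[R]_2) : 'rV[R]_(2 + 1) := row_mx d 0.

Definition projective_line (A d : 'rV[R]_2) : set 'rV[R]_(2 + 1) :=
  [set v | exists s t : R, v = s *: affine_point A + t *: infinite_point d].

Definition bisector (A B C : 'rV[R]_2) : 'rV[R]_2 :=
  (enorm (B - A))^-1 *: (B - A) + (enorm (C - A))^-1 *: (C - A).

Definition reflect_dir (u v : 'rV[R]_2) : 'rV[R]_2 :=
  (2 * dot v u / dot u u) *: u - v.

(* The cevian [AP] of the triangle [ABC] reflected about the bisector of the
   angle at [A], completed with its point at infinity. *)
Definition reflected_cevian (A B C P : 'rV[R]_2) : set 'rV[R]_(2 + 1) :=
  projective_line A (reflect_dir (bisector A B C) (P - A)).

(* When [P] is a vertex one of the cevians is undefined, and so is the isogonal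
   conjugate (its barycentrics would be [0 : 0 : 0]). When [P] lies on the
   circumcircle the point of concurrence is at infinity. *)
Definition isogonal_conjugate (A B C P : 'rV[R]_2) (v : 'rV[R]_(2 + 1)) : Prop :=
  [/\ [/\ P <> A, P <> B & P <> C],
      v <> 0 &
      [/\ reflected_cevian A B C P v,
          reflected_cevian B C A P v &
          reflected_cevian C A B P v]].

Definition isogonal_locus (E Ec : set 'rV[R]_2) (P : 'rV[R]_2) :
    set 'rV[R]_(2 + 1) :=
  [set v | exists A B C,
     poncelet_triangle E Ec A B C /\ isogonal_conjugate A B C P v].

Definition quadric (M : 'M[R]_(2 + 1)) : set 'rV[R]_(2 + 1) :=
  [set v | v <> 0 /\ v *m M *m v^T = 0].

Definition punctured_line (l : 'cV[R]_(2 + 1)) (w : 'rV[R]_(2 + 1)) :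
    set 'rV[R]_(2 + 1) :=
  [set v | v *m l = 0 /\ ~ exists k : R, v = k *: w].

(* A conic is the whole real zero set, nonempty, of a nonzero ternary quadratic
   form of any rank (so lines, pairs of lines and single points are allowed), or
   a line deprived of one of its points. *)
Definition is_conic (S : set 'rV[R]_(2 + 1)) : Prop :=
  S !=set0 /\
  ((exists M : 'M[R]_(2 + 1), [/\ M^T = M, M <> 0 & S = quadric M]) \/
   (exists (l : 'cV[R]_(2 + 1)) (w : 'rV[R]_(2 + 1)),
      [/\ l <> 0, w <> 0, w *m l = 0 & S = punctured_line l w])).

End Plane.

(* Main.v *)
Require Import Defs.
From mathcomp Require Import all_boot all_order all_algebra.
From mathcomp Require Import boolp classical_sets reals.
From mathcomp Require Import ring lra.

Set Implicit Arguments.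
Unset Strict Implicit.
Unset Printing Implicit Defensive.

Import Order.TTheory GRing.Theory Num.Theory.
Local Open Scope classical_set_scope.
Local Open Scope ring_scope.

(** Points are read in homogeneous coordinates. Let [E] and [m] be the
    symmetric bilinear forms of the outer ellipse and of the caustic.

    Poncelet triangles are orthogonal frames. Rescale the lifts of the
    vertices of one Poncelet triangle into a basis with coordinates [y1, y2,
    y3] such that the outer ellipse is [y2 y3 + y3 y1 + y1 y2 = 0], and let
    [phi = f y1^2 + g y2^2 + h y3^2], where [f, g, h] are read off the
    caustic. The chord [XY] is tangent to the caustic when [m(X,X) m(Y,Y) -
    m(X,Y)^2 = 0], and for [X], [Y] on the outer ellipse the left-hand side is
    a constant times [phi(X,Y) E(X,Y)] ([chord_polar_identity]). Since [E(X,Y)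
    <> 0] for distinct points of the ellipse, the vertices of every Poncelet
    triangle are pairwise [phi]-orthogonal: all these triangles are self-polar
    for one conic ([tangent_polar]). The caustic lies inside the ellipse, so
    that it touches the sides between the vertices, and this makes [phi]
    positive definite ([tangent_chord], [base_fgh]).

    Isogonal conjugation is linear once the triangle is traded for a scalar.
    [P] and [v] are isogonal conjugates when the products of their signed
    distances to each of the three sides agree ([isogonal_conjugateP]). The
    side opposite to a vertex [X] is the polar line of [X], so the condition
    is that [S_v(X) = phi(X,P) phi(X,v) - k J(X)] vanishes at the three
    vertices, where [J(X)] is the squared length of the normal of the polar
    line of [X]. By Parseval for an orthogonal frame, [k] is [phi(P,v)] over
    the trace of [J] whatever the triangle ([confocal_iff_proportional]). Thus
    [S_v] is a traceless quadratic form depending linearly on [v].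

    The triangle is then eliminated. In the parametrization [Y(s,t) = (t r, r
    s, s t)], [r = - s - t], of the outer ellipse there are two binary cubics
    [F0], [F1] such that orthogonality of two points is equality of their
    values of [F0 : F1] ([polar_form_cone]): the vertices of a triangle are
    the roots of one member of a pencil. A traceless form restricts to [L1 F1
    + L0 F0] with [L0], [L1] linear in [(s,t)] ([confocal_cone]), and it
    vanishes on the roots of a member of the pencil exactly when [L0] and [L1]
    are proportional, in the ratio given by that member. For [S_v] this says
    that a two-by-two determinant, a quadratic form in [v], is zero
    ([frame_discriminant]). Conversely, if it is zero the corresponding real
    cubic has a real root, and by the porism that root is a vertex of a
    triangle ([discriminant_frame]); so all real points of the quadric are
    reached.

    If [P] is off the ellipse this quadric is the locus
    ([frame_locus_off_cone]). If [P] is on the ellipse, start from the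
    triangle with vertex [P]: the determinant factors as [k(v) l(v)], the
    factor [k] comes from that one triangle, for which the conjugate is
    undefined, and the locus is the line [l = 0] without its point on [k = 0]
    ([frame_locus_at_vertex]). *)

(** * Coordinates and linear forms *)

Section Coordinates.
Variable R : realType.
Implicit Types (X Y : 'rV[R]_2) (v w : 'rV[R]_(2 + 1)).

Definition cx v : R := v 0 (lshift 1 0).
Definition cy v : R := v 0 (lshift 1 1).
Definition cw v : R := v 0 (rshift 2 0).

Lemma eq_plane X Y :
  abscissa X = abscissa Y -> ordinate X = ordinate Y -> X = Y.
Proof.
move=> h0 h1; apply/rowP => i.
by case: i => [[|[|//]] hi]; [move: h0|move: h1]; rewrite /abscissa /ordinate;
  congr (_ = _); congr (_ _ _); apply: val_inj.
Qed.

Lemma eq_space v w : cx v = cx w -> cy v = cy w -> cw v = cw w -> v = w.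
Proof.
move=> h0 h1 h2; apply/rowP => i.
by case: i => [[|[|[|//]]] hi]; [move: h0|move: h1|move: h2];
  rewrite /cx /cy /cw; congr (_ = _); congr (_ _ _); apply: val_inj.
Qed.

Lemma cxD v w : cx (v + w) = cx v + cx w. Proof. by rewrite /cx mxE. Qed.
Lemma cyD v w : cy (v + w) = cy v + cy w. Proof. by rewrite /cy mxE. Qed.
Lemma cwD v w : cw (v + w) = cw v + cw w. Proof. by rewrite /cw mxE. Qed.
Lemma cxZ k v : cx (k *: v) = k * cx v. Proof. by rewrite /cx mxE. Qed.
Lemma cyZ k v : cy (k *: v) = k * cy v. Proof. by rewrite /cy mxE. Qed.
Lemma cwZ k v : cw (k *: v) = k * cw v. Proof. by rewrite /cw mxE. Qed.
Lemma cx0 : cx 0 = 0. Proof. by rewrite /cx mxE. Qed.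
Lemma cy0 : cy 0 = 0. Proof. by rewrite /cy mxE. Qed.
Lemma cw0 : cw 0 = 0. Proof. by rewrite /cw mxE. Qed.
Lemma cx_affine X : cx (affine_point X) = abscissa X.
Proof. by rewrite /cx /affine_point row_mxEl. Qed.
Lemma cy_affine X : cy (affine_point X) = ordinate X.
Proof. by rewrite /cy /affine_point row_mxEl. Qed.
Lemma cw_affine X : cw (affine_point X) = 1.
Proof. by rewrite /cw /affine_point row_mxEr mxE. Qed.
Lemma cx_infinite X : cx (infinite_point X) = abscissa X.
Proof. by rewrite /cx /infinite_point row_mxEl. Qed.
Lemma cy_infinite X : cy (infinite_point X) = ordinate X.
Proof. by rewrite /cy /infinite_point row_mxEl. Qed.
Lemma cw_infinite X : cw (infinite_point X) = 0.
Proof. by rewrite /cw /infinite_point row_mxEr mxE. Qed.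

Definition coordE := (cxD, cyD, cwD, cxZ, cyZ, cwZ, cx0, cy0, cw0, cx_affine,
  cy_affine, cw_affine, cx_infinite, cy_infinite, cw_infinite).

Lemma abscissaD X Y : abscissa (X + Y) = abscissa X + abscissa Y.
Proof. by rewrite /abscissa mxE. Qed.
Lemma ordinateD X Y : ordinate (X + Y) = ordinate X + ordinate Y.
Proof. by rewrite /ordinate mxE. Qed.
Lemma abscissaN X : abscissa (- X) = - abscissa X.
Proof. by rewrite /abscissa mxE. Qed.
Lemma ordinateN X : ordinate (- X) = - ordinate X.
Proof. by rewrite /ordinate mxE. Qed.
Lemma abscissaZ k X : abscissa (k *: X) = k * abscissa X.
Proof. by rewrite /abscissa mxE. Qed.
Lemma ordinateZ k X : ordinate (k *: X) = k * ordinate X.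
Proof. by rewrite /ordinate mxE. Qed.
Lemma abscissa_perp X : abscissa (perp X) = - ordinate X.
Proof. by rewrite /abscissa mxE. Qed.
Lemma ordinate_perp X : ordinate (perp X) = abscissa X.
Proof. by rewrite /ordinate mxE. Qed.
Lemma dotE X Y : dot X Y = abscissa X * abscissa Y + ordinate X * ordinate Y.
Proof.
rewrite /dot mxE big_ord_recl big_ord1 !mxE /abscissa /ordinate.
by congr (_ + _ * _); congr (_ _ _); apply: val_inj.
Qed.
Definition planeE := (abscissaD, ordinateD, abscissaN, ordinateN, abscissaZ,
  ordinateZ, abscissa_perp, ordinate_perp, dotE).

Lemma affine_point_inj k X Y :
  affine_point X = k *: affine_point Y -> X = Y.
Proof.
move=> e; have := congr1 cw e; rewrite !coordE mulr1 => k1.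
have := congr1 cx e; have := congr1 cy e; rewrite !coordE -k1 !mul1r.
by move=> ? ?; apply: eq_plane.
Qed.

(** A predicate on bare functions, so that forms such as determinants with two
    fixed arguments need no bundling. *)
Definition linear_form (l : 'rV[R]_(2 + 1) -> R) : Prop :=
  exists c : 'cV[R]_(2 + 1), forall v, l v = (v *m c) 0 0.

Lemma linear_formD l l' : linear_form l -> linear_form l' ->
  linear_form (fun v => l v + l' v).
Proof.
move=> [c hc] [c' hc']; exists (c + c') => v.
by rewrite mulmxDr mxE hc hc'.
Qed.

Lemma linear_formZ k l : linear_form l -> linear_form (fun v => k * l v).
Proof. by move=> [c hc]; exists (k *: c) => v; rewrite -scalemxAr mxE hc. Qed.

Lemma linear_formZr k l : linear_form l -> linear_form (fun v => l v * k).
Proof.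
move=> [c hc]; exists (k *: c) => v.
by rewrite -scalemxAr mxE hc mulrC.
Qed.

Lemma linear_formN l : linear_form l -> linear_form (fun v => - l v).
Proof. by move=> [c hc]; exists (- c) => v; rewrite mulmxN mxE hc. Qed.

Lemma linear_form_coord j : linear_form (fun v => v 0 j).
Proof.
exists (delta_mx j 0) => v; rewrite mxE (bigD1 j) //= big1 ?addr0.
  by rewrite mxE !eqxx mulr1.
by move=> i /negbTE ne; rewrite mxE ne mulr0.
Qed.

Lemma linear_form_add (l : 'rV[R]_(2 + 1) -> R) v w :
  linear_form l -> l (v + w) = l v + l w.
Proof. by move=> [c hc]; rewrite !hc mulmxDl mxE. Qed.

Lemma linear_form_scale (l : 'rV[R]_(2 + 1) -> R) k v :
  linear_form l -> l (k *: v) = k * l v.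
Proof. by move=> [c hc]; rewrite !hc -scalemxAl mxE. Qed.

Lemma linear_form0 (l : 'rV[R]_(2 + 1) -> R) : linear_form l -> l 0 = 0.
Proof. by move=> [c hc]; rewrite hc mul0mx mxE. Qed.

Lemma linear_form_cx : linear_form (cx). Proof. exact: linear_form_coord. Qed.
Lemma linear_form_cy : linear_form (cy). Proof. exact: linear_form_coord. Qed.
Lemma linear_form_cw : linear_form (cw). Proof. exact: linear_form_coord. Qed.

(** The shape in which the equation of the locus appears, a two-by-two
    determinant of linear forms, is the zero set of a symmetric matrix. *)
Lemma quadric_of_forms l1 l2 l3 l4 :
  linear_form l1 -> linear_form l2 -> linear_form l3 -> linear_form l4 ->
  exists M : 'M[R]_(2 + 1), M^T = M /\
    quadric M = [set v | v <> 0 /\ l1 v * l2 v - l3 v * l4 v = 0].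
Proof.
move=> [c1 h1] [c2 h2] [c3 h3] [c4 h4].
exists ((c1 *m c2^T + c2 *m c1^T) - (c3 *m c4^T + c4 *m c3^T)); split.
  have T (c c' : 'cV[R]_(2 + 1)) : (c *m c'^T + c' *m c^T)^T =
      c *m c'^T + c' *m c^T.
    by rewrite linearD /= !trmx_mul !trmxK addrC.
  by rewrite linearB /= !T.
have E1 (c c' : 'cV[R]_(2 + 1)) v :
    (v *m (c *m c'^T) *m v^T) 0 0 = (v *m c) 0 0 * (v *m c') 0 0.
  rewrite mulmxA -mulmxA -(trmx_mul v c').
  by rewrite mxE big_ord1 [_^T _ _]mxE !ord1.
have key v : (v *m (c1 *m c2^T + c2 *m c1^T - (c3 *m c4^T + c4 *m c3^T)) *m v^T)
    0 0 = 2 * (l1 v * l2 v - l3 v * l4 v).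
  rewrite mulmxBr !mulmxDr mulmxBl !mulmxDl.
  have sub00 (m m' : 'M[R]_1) : (m - m') 0 0 = m 0 0 - m' 0 0 by rewrite !mxE.
  have add00 (m m' : 'M[R]_1) : (m + m') 0 0 = m 0 0 + m' 0 0 by rewrite !mxE.
  by rewrite sub00 !add00 !E1 h1 h2 h3 h4; ring.
apply/seteqP; split=> v [v0 e]; split=> //.
  move/(congr1 (fun m : 'M[R]_1 => m 0 0)): e; rewrite key mxE => /eqP.
  by rewrite mulf_eq0 pnatr_eq0 /= => /eqP.
by apply/matrixP => i j; rewrite !ord1 key e mulr0 mxE.
Qed.

End Coordinates.

(** * The pencil of binary cubics attached to a triangle *)

Lemma lform2_eq0 (R : fieldType) (a b s t s' t' : R) :
  s * t' - t * s' != 0 -> a * s + b * t = 0 -> a * s' + b * t' = 0 ->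
  a = 0 /\ b = 0.
Proof.
move=> w e e'; split; apply: (mulIf w); rewrite mul0r.
  by transitivity ((a * s + b * t) * t' - (a * s' + b * t') * t);
    [ring|rewrite e e' !mul0r subrr].
by transitivity ((a * s' + b * t') * s - (a * s + b * t) * s');
  [ring|rewrite e e' !mul0r subrr].
Qed.

Lemma det2_eq0 (R : fieldType) (a b c d : R) : a * d - b * c = 0 ->
  exists l m, [/\ (l != 0) || (m != 0), l * a + m * c = 0 & l * b + m * d = 0].
Proof.
move=> e; have [a0|a0] := eqVneq a 0; last first.
  exists (- c), a; split; rewrite ?a0 ?orbT //; first by ring.
  by rewrite -e; ring.
have [b0|b0] := eqVneq b 0.
  by exists 1, 0; rewrite oner_neq0 a0 b0; split=> //; ring.
exists (- d), b; split; rewrite ?b0 ?orbT //; last by ring.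
by rewrite -[RHS]oppr0 -e; ring.
Qed.

(** A form of odd degree has a real zero on the projective line; the zero is
    at infinity when the leading coefficient vanishes, and otherwise lies
    within the bound [M] on the roots of a monic cubic. *)
Lemma cubic_root (R : rcfType) (c0 c1 c2 c3 : R) :
  exists s t, (s != 0) || (t != 0) /\
    c0 * s ^+ 3 + c1 * s ^+ 2 * t + c2 * s * t ^+ 2 + c3 * t ^+ 3 = 0.
Proof.
have [c00|c00] := eqVneq c0 0.
  by exists 1, 0; split; [rewrite oner_neq0|rewrite c00; ring].
pose b1 := c1 / c0; pose b2 := c2 / c0; pose b3 := c3 / c0.
pose q : {poly R} := 'X^3 + b1 *: 'X^2 + b2 *: 'X + b3%:P.
have qE x : q.[x] = x ^+ 3 + b1 * x ^+ 2 + b2 * x + b3 by rewrite !hornerE.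
pose M := 1 + `|b1| + `|b2| + `|b3|.
have M1 : 1 <= M by rewrite /M -!addrA lerDl !addr_ge0.
have bnd x : `|x| = M -> `|b1 * x ^+ 2 + b2 * x + b3| <= M ^+ 3.
  move=> xM; apply: (@le_trans _ _ (`|b1| * M ^+ 2 + `|b2| * M + `|b3|)).
    by rewrite -xM -normrX -!normrM (le_trans (ler_normD _ _)) // lerD2r ler_normD.
  have h1 : M <= M ^+ 2 by rewrite expr2 ler_peMl //; lra.
  have h2 : 1 <= M ^+ 2 by lra.
  have -> : M ^+ 3 = (1 + `|b1| + `|b2| + `|b3|) * M ^+ 2 by rewrite exprS.
  have n2 : `|b2| * M <= `|b2| * M ^+ 2 by apply: ler_wpM2l.
  have n3 : `|b3| * 1 <= `|b3| * M ^+ 2 by apply: ler_wpM2l.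
  by lra.
have [] := @poly_ivt R q (- M) M; first by lra.
  rewrite !qE.
  have := bnd M; have := bnd (- M); rewrite normrN ger0_norm; last by lra.
  move=> /(_ erefl); rewrite ler_norml => /andP[_ hN] /(_ erefl).
  rewrite ler_norml => /andP[hP _].
  have -> : (- M) ^+ 3 = - M ^+ 3 by ring.
  by apply/andP; split; lra.
move=> x _ /eqP; rewrite qE => qx.
exists x, 1; split; first by rewrite oner_neq0 orbT.
transitivity (c0 * (x ^+ 3 + b1 * x ^+ 2 + b2 * x + b3)); last by rewrite qx mulr0.
by rewrite /b1 /b2 /b3; field.
Qed.

Section Pencil.
Variable R : rcfType.
Variables f g h : R.
Hypotheses (f0 : 0 < f) (g0 : 0 < g) (h0 : 0 < h).

(** The roots of [base_cubic] are the parameters of the three vertices of the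
    base triangle in the parametrization of [cone_param]. *)
Definition base_cubic (s t : R) : R := s * t * - (s + t).

(** A second member of the pencil. It is determined modulo [base_cubic] by
    [polar_form_cone]; this choice is the one alternating under permutations
    of the three coordinates together with [f], [g], [h]. *)
Definition second_cubic (s t : R) : R :=
  let r := - (s + t) in
  f * t * r * (t - r) + g * r * s * (r - s) + h * s * t * (s - t).

Definition polar_form (x1 x2 x3 y1 y2 y3 : R) : R :=
  f * x1 * y1 + g * x2 * y2 + h * x3 * y3.

Lemma polar_form_gt0 x1 x2 x3 :
  [|| x1 != 0, x2 != 0 | x3 != 0] -> 0 < polar_form x1 x2 x3 x1 x2 x3.
Proof.
move=> n0; have -> : polar_form x1 x2 x3 x1 x2 x3 =
  f * x1 ^+ 2 + g * x2 ^+ 2 + h * x3 ^+ 2 by rewrite /polar_form; ring.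
have p1 := mulr_ge0 (ltW f0) (sqr_ge0 x1).
have p2 := mulr_ge0 (ltW g0) (sqr_ge0 x2).
have p3 := mulr_ge0 (ltW h0) (sqr_ge0 x3).
have sq (x : R) : x != 0 -> 0 < x ^+ 2 by rewrite exprn_even_gt0.
case/or3P: n0 => /sq n.
- by have := mulr_gt0 f0 n; lra.
- by have := mulr_gt0 g0 n; lra.
- by have := mulr_gt0 h0 n; lra.
Qed.

(** Poncelet's theorem in algebraic form: two distinct points of the conic are
    orthogonal exactly when they have the same image under the degree three
    map [base_cubic : second_cubic], so the vertices of each self-polar
    triangle are a fibre of that map. *)
Lemma polar_form_cone s t s' t' :
  let r := - (s + t) in let r' := - (s' + t') in
  2 * polar_form (t * r) (r * s) (s * t) (t' * r') (r' * s') (s' * t') *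
    (s * t' - t * s') =
  base_cubic s t * second_cubic s' t' - second_cubic s t * base_cubic s' t'.
Proof. by rewrite /polar_form /base_cubic /second_cubic /=; ring. Qed.

(** At a root of [base_cubic] only one of the three terms of [second_cubic]
    survives, so the degree three map of the pencil has no base point. *)
Lemma pencil_coprime s t : base_cubic s t = 0 -> second_cubic s t = 0 ->
  s = 0 /\ t = 0.
Proof.
rewrite /base_cubic /second_cubic => /eqP; rewrite mulf_eq0 oppr_eq0 mulf_eq0.
have aux (k x : R) : 0 < k -> 2 * k * x ^+ 3 = 0 -> x = 0.
  move=> k0 /eqP; rewrite -mulrA mulf_eq0 pnatr_eq0 mulf_eq0 (gt_eqF k0) /=.
  by rewrite expf_eq0 /= => /eqP.
case/orP => [/orP[]|] /eqP e e1.
- split=> //; apply: (aux f) => //; rewrite -[RHS]oppr0 -e1 e; ring.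
- split=> //; apply: (aux g) => //; rewrite -e1 e; ring.
- have es : s = - t by apply/eqP; rewrite -addr_eq0 e.
  suff t0 : t = 0 by rewrite es t0 oppr0.
  apply: (aux h) => //; rewrite -e1 es; ring.
Qed.

(** The parametrization inverts coordinates: up to a common factor they are
    [1/s], [1/t], [1/r] with [s + t + r = 0], so that [s : t] is [x2 : x1];
    the vertex [x1 = x2 = 0] has to be treated apart. *)
Lemma cone_param (x1 x2 x3 : R) :
  x2 * x3 + x3 * x1 + x1 * x2 = 0 -> [|| x1 != 0, x2 != 0 | x3 != 0] ->
  exists c s t, [/\ c != 0, x1 = c * (t * - (s + t)), x2 = c * (- (s + t) * s)
    & x3 = c * (s * t)].
Proof.
move=> e n0; have [z|z] := eqVneq (x1 + x2) 0.
  have E : x2 = - x1 by apply/eqP; rewrite -addr_eq0 addrC z.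
  have x10 : x1 = 0.
    apply/eqP; rewrite -sqrf_eq0; apply/eqP.
    by rewrite -[RHS]oppr0 -e E; ring.
  have x20 : x2 = 0 by rewrite E x10 oppr0.
  exists (- x3), 1, (-1); move: n0; rewrite x10 x20 eqxx /= oppr_eq0 => ->.
  by split=> //; ring.
exists (- (x1 + x2)^-1), x2, x1; split.
- by rewrite oppr_eq0 invr_eq0.
- by field.
- by field.
- apply: (mulIf z); transitivity (- (x1 * x2)); last by field.
  by apply/eqP; rewrite -subr_eq0 -[X in _ == X]e; apply/eqP; ring.
Qed.

End Pencil.

(** On the dual side the left-hand side is four times [f g h] times the dual
    conic [f w2 w3 + g w3 w1 + h w1 w2] evaluated at the cross product of [x]
    and [y]. The right-hand side is forced up to a constant: as a function of
    [y] on the conic, both sides vanish doubly at [x] and once at each of the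
    two points where the tangents drawn from [x] meet the conic again. *)
Lemma chord_polar_identity (R : comPzRingType) (f g h x1 x2 x3 y1 y2 y3 : R) :
  x2 * x3 + x3 * x1 + x1 * x2 = 0 -> y2 * y3 + y3 * y1 + y1 * y2 = 0 ->
  let form (z1 z2 z3 w1 w2 w3 : R) :=
    f ^+ 2 * z1 * w1 + g ^+ 2 * z2 * w2 + h ^+ 2 * z3 * w3
    - g * h * (z2 * w3 + z3 * w2) - h * f * (z3 * w1 + z1 * w3)
    - f * g * (z1 * w2 + z2 * w1) in
  form x1 x2 x3 x1 x2 x3 * form y1 y2 y3 y1 y2 y3
    - form x1 x2 x3 y1 y2 y3 ^+ 2 =
  4 * (f * g * h) * (f * x1 * y1 + g * x2 * y2 + h * x3 * y3) *
    (x2 * y3 + x3 * y2 + (x3 * y1 + x1 * y3) + (x1 * y2 + x2 * y1)).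
Proof.
move=> cx cy form; apply/eqP; rewrite -subr_eq0; apply/eqP.
transitivity (- 4 * (f * g * h) *
  ((f * y1 ^+ 2 + g * y2 ^+ 2 + h * y3 ^+ 2) * (x2 * x3 + x3 * x1 + x1 * x2)
  + (f * x1 ^+ 2 + g * x2 ^+ 2 + h * x3 ^+ 2) * (y2 * y3 + y3 * y1 + y1 * y2))).
  by rewrite /form; ring.
by rewrite cx cy; ring.
Qed.

(** * The locus seen from a self-polar triangle *)

Section Locus.
Variable R : realType.
Local Notation space := 'rV[R]_(2 + 1).
Implicit Types (v w X Y Z : space).

Variables f g h : R.
Hypotheses (f0 : 0 < f) (g0 : 0 < g) (h0 : 0 < h).
Variables Y1 Y2 Y3 : space -> R.
Hypotheses (Y1lin : linear_form Y1) (Y2lin : linear_form Y2)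
  (Y3lin : linear_form Y3).
Hypothesis Yinj : forall v w, Y1 v = Y1 w -> Y2 v = Y2 w -> Y3 v = Y3 w -> v = w.
Hypothesis Ysurj : forall x1 x2 x3, exists v,
  [/\ Y1 v = x1, Y2 v = x2 & Y3 v = x3].

Definition polar v w := polar_form f g h (Y1 v) (Y2 v) (Y3 v) (Y1 w) (Y2 w) (Y3 w).
(** The outer ellipse in the coordinates adapted to the base triangle. *)
Definition cone v := Y2 v * Y3 v + Y3 v * Y1 v + Y1 v * Y2 v = 0.

Definition polar_frame X Y Z : Prop :=
  [/\ [/\ X <> 0, Y <> 0 & Z <> 0], [/\ cone X, cone Y & cone Z] &
      [/\ polar X Y = 0, polar Y Z = 0 & polar Z X = 0]].

Lemma coord_neq0 v : v <> 0 -> [|| Y1 v != 0, Y2 v != 0 | Y3 v != 0].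
Proof.
move=> v0; apply/negP => /negP; rewrite !negb_or !negbK.
move=> /and3P[/eqP e1 /eqP e2 /eqP e3].
by apply: v0; apply: Yinj; rewrite linear_form0.
Qed.

Lemma polar_gt0 v : v <> 0 -> 0 < polar v v.
Proof. by move=> v0; apply: polar_form_gt0 => //; exact: coord_neq0. Qed.

Lemma polarC v w : polar v w = polar w v.
Proof. by rewrite /polar /polar_form; ring. Qed.

Lemma polarD u v w : polar u (v + w) = polar u v + polar u w.
Proof. by rewrite /polar /polar_form !linear_form_add //; ring. Qed.

Lemma polarZ u k v : polar u (k *: v) = k * polar u v.
Proof. by rewrite /polar /polar_form !linear_form_scale //; ring. Qed.

Lemma linear_form_polar w : linear_form (polar w).
Proof.
apply: linear_formD; last exact: linear_formZ.
by apply: linear_formD; exact: linear_formZ.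
Qed.

(** The triangles are kept abstract here: all that matters is that they are
    orthogonal frames with vertices on the cone, and that every point of the
    cone is a vertex of one of them. *)
Variable porism : set (space * space * space).
Hypothesis porism_frame : forall X Y Z, porism (X, Y, Z) -> polar_frame X Y Z.
Hypothesis porism_vertex : forall X, X <> 0 -> cone X ->
  exists (c : R) Y Z, c != 0 /\ porism (c *: X, Y, Z).

Variables P I J : space.
Hypothesis P0 : P <> 0.
(** [I] and [J] stand for the two infinite points that span an orthonormal
    basis of directions; the hypotheses say that no side of the base triangle
    is the line at infinity. *)
Hypothesis N11 : 0 < Y1 I ^+ 2 + Y1 J ^+ 2.
Hypothesis N22 : 0 < Y2 I ^+ 2 + Y2 J ^+ 2.
Hypothesis N33 : 0 < Y3 I ^+ 2 + Y3 J ^+ 2.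

(** The trace, with respect to [polar], of the quadratic form [X |-> polar X I
    ^+ 2 + polar X J ^+ 2], which is the squared length of the normal of the
    polar line of [X]. *)
Definition trace := polar I I + polar J J.
Definition confocal_ratio v := polar P v / trace.

Lemma trace_gt0 : 0 < trace.
Proof.
have -> : trace = f * (Y1 I ^+ 2 + Y1 J ^+ 2) + g * (Y2 I ^+ 2 + Y2 J ^+ 2)
  + h * (Y3 I ^+ 2 + Y3 J ^+ 2) by rewrite /trace /polar /polar_form; ring.
by rewrite !addr_gt0 // mulr_gt0.
Qed.

(** As [X] varies, the polar lines of the zeros of this form are the tangents
    of a conic, possibly degenerate, with foci [P] and [v]. *)
Definition confocal v X :=
  polar X P * polar X v - confocal_ratio v * (polar X I ^+ 2 + polar X J ^+ 2).

Definition frame_locus : set space := [set v | v <> 0 /\ exists X Y Z,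
  [/\ porism (X, Y, Z),
      [/\ forall c, P <> c *: X, forall c, P <> c *: Y & forall c, P <> c *: Z] &
      [/\ confocal v X = 0, confocal v Y = 0 & confocal v Z = 0]]].

(** Up to the weights [f], [g], [h], the matrix entries of [confocal v] in the
    adapted coordinates. *)
Definition entry (Ya Yb : space -> R) v :=
  (Ya P * Yb v + Yb P * Ya v) / 2 - confocal_ratio v * (Ya I * Yb I + Ya J * Yb J).

(** The diagonal entries and the two numbers [base_coef_s], [base_coef_t] are
    the coefficients in the expansion of [confocal_cone]: the diagonal entries
    govern the multiple of [second_cubic], since up to weights they are the
    values of the form at the roots of [base_cubic]. *)
Definition diag1 v := f * entry Y1 Y1 v.
Definition diag2 v := g * entry Y2 Y2 v.
Definition diag3 v := h * entry Y3 Y3 v.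
Definition base_coef_s v :=
  4 * (g * h * entry Y2 Y3 v - f * g * entry Y1 Y2 v)
  - (f * diag2 v - g * diag2 v - 2 * g * diag3 v + h * diag3 v + h * diag1 v).
Definition base_coef_t v :=
  4 * (f * h * entry Y1 Y3 v - f * g * entry Y1 Y2 v)
  - (f * (diag1 v + 2 * diag2 v) - g * (diag2 v + diag3 v) - h * diag1 v).

(** The value of [confocal_ratio] is chosen to make [confocal] traceless. *)
Lemma coef_trace v : diag1 v + diag2 v + diag3 v = 0.
Proof.
have t0 := lt0r_neq0 trace_gt0.
have -> : diag1 v + diag2 v + diag3 v = polar P v - confocal_ratio v * trace.
  by rewrite /diag1 /diag2 /diag3 /entry /trace /polar /polar_form; field.
by rewrite /confocal_ratio mulfVK // subrr.
Qed.

(** Quartic forms in [(s, t)] make up a space of dimension five, and those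
    obtained from traceless quadratic forms are the hyperplane of combinations
    of the two cubics with linear coefficients. *)
Lemma confocal_cone v X c s t :
  Y1 X = c * (t * - (s + t)) -> Y2 X = c * (- (s + t) * s) ->
  Y3 X = c * (s * t) ->
  2 * confocal v X = c ^+ 2 *
    ((diag2 v * s - diag1 v * t) * second_cubic f g h s t
     + (base_coef_s v * s + base_coef_t v * t) * base_cubic s t).
Proof.
move=> e1 e2 e3.
have t0 : diag3 v = - diag1 v - diag2 v.
  by apply/eqP; rewrite -subr_eq0 opprB addrC opprK -(coef_trace v);
  apply/eqP; ring.
transitivity (c ^+ 2 * 2 *
  (f * diag1 v * (t * - (s + t)) ^+ 2 + g * diag2 v * (- (s + t) * s) ^+ 2
   + h * diag3 v * (s * t) ^+ 2 + 2 * (s * t * - (s + t)) *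
     (g * h * entry Y2 Y3 v * s
   + f * h * entry Y1 Y3 v * t - f * g * entry Y1 Y2 v * (s + t)))).
  rewrite /confocal /diag1 /diag2 /diag3 /entry /polar /polar_form e1 e2 e3.
  by field.
by rewrite /base_coef_s /base_coef_t t0 /second_cubic /base_cubic /=; ring.
Qed.

Definition discriminant v := diag2 v * base_coef_t v - - diag1 v * base_coef_s v.

Lemma cone_paramP X : X <> 0 -> cone X -> exists c s t,
  [/\ c != 0, Y1 X = c * (t * - (s + t)), Y2 X = c * (- (s + t) * s)
    & Y3 X = c * (s * t)].
Proof. by move=> X0 cX; apply: cone_param => //; exact: coord_neq0. Qed.

(** Orthogonal points of the cone have distinct parameters because [polar] is
    definite. *)
Lemma param_polar X X' c s t c' s' t' :
  X <> 0 -> X' <> 0 -> polar X X' = 0 -> c != 0 -> c' != 0 ->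
  Y1 X = c * (t * - (s + t)) -> Y2 X = c * (- (s + t) * s) -> Y3 X = c * (s * t) ->
  Y1 X' = c' * (t' * - (s' + t')) -> Y2 X' = c' * (- (s' + t') * s') ->
  Y3 X' = c' * (s' * t') ->
  s * t' - t * s' != 0 /\
  base_cubic s t * second_cubic f g h s' t' =
    second_cubic f g h s t * base_cubic s' t'.
Proof.
move=> X0 X'0 o c0 c'0 e1 e2 e3 e1' e2' e3'; split; last first.
  apply/eqP; rewrite -subr_eq0 -(polar_form_cone f g h) /=; apply/eqP.
  rewrite -[RHS](mul0r (2 * (c * c')^-1 * (s * t' - t * s'))) -o /polar /polar_form.
  by rewrite e1 e2 e3 e1' e2' e3'; field; rewrite c0 c'0.
apply/eqP => w; have /lt0r_neq0/eqP := polar_gt0 X0; apply.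
have st' : s' * t = s * t'.
  by apply/eqP; rewrite -subr_eq0 -[_ == 0]oppr_eq0 -w; apply/eqP; ring.
have [s'0|s'0] := eqVneq s' 0; last first.
  have -> : polar X X = c * (s / s') ^+ 2 / c' * polar X X'.
    rewrite /polar /polar_form e1 e2 e3 e1' e2' e3'.
    have -> : t = s * t' / s' by rewrite -st' mulrC mulKf.
    by field; rewrite s'0.
  by rewrite o mulr0.
have t'0 : t' != 0.
  apply/eqP => t'0; apply: X'0.
  by apply: Yinj; rewrite linear_form0 ?e1' ?e2' ?e3' // s'0 t'0; ring.
have s0 : s = 0 by apply: (mulIf t'0); rewrite -st' s'0; ring.
have -> : polar X X = c * (t / t') ^+ 2 / c' * polar X X'.
  by rewrite /polar /polar_form e1 e2 e3 e1' e2' e3' s0 s'0; field; rewrite c'0.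
by rewrite o mulr0.
Qed.

(** At two vertices the pair [base_cubic : second_cubic] is the same, so one
    fixed combination of the two linear coefficients of [confocal_cone]
    vanishes at two distinct parameters, hence identically. *)
Lemma frame_discriminant v X Y : X <> 0 -> Y <> 0 -> cone X -> cone Y ->
  polar X Y = 0 -> confocal v X = 0 -> confocal v Y = 0 -> discriminant v = 0.
Proof.
move=> X0 Y0 cX cY o SX SY.
have [c [s [t [c0 e1 e2 e3]]]] := cone_paramP X0 cX.
have [c' [s' [t' [c'0 e1' e2' e3']]]] := cone_paramP Y0 cY.
have [w e] := param_polar X0 Y0 o c0 c'0 e1 e2 e3 e1' e2' e3'.
have cub_eq0 Z k a b : k != 0 -> Y1 Z = k * (b * - (a + b)) ->
    Y2 Z = k * (- (a + b) * a) -> Y3 Z = k * (a * b) -> confocal v Z = 0 ->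
    (diag2 v * a - diag1 v * b) * second_cubic f g h a b
     + (base_coef_s v * a + base_coef_t v * b) * base_cubic a b = 0.
  move=> k0 h1 h2 h3 SZ; apply: (mulfI (_ : k ^+ 2 != 0)); first by rewrite expf_eq0.
  by rewrite -(confocal_cone v h1 h2 h3) SZ !mulr0.
have E := cub_eq0 _ _ _ _ c0 e1 e2 e3 SX.
have E' := cub_eq0 _ _ _ _ c'0 e1' e2' e3' SY.
pose a := second_cubic f g h s t * diag2 v + base_cubic s t * base_coef_s v.
pose b := second_cubic f g h s t * - diag1 v + base_cubic s t * base_coef_t v.
have st0 : base_cubic s t != 0 \/ second_cubic f g h s t != 0.
  have [z|] := eqVneq (base_cubic s t) 0; last by left.
  right; apply/eqP => z'; have [s0 t0] := pencil_coprime f0 g0 h0 z z'.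
  by case/eqP: w; rewrite s0 t0; ring.
have s't'0 : base_cubic s' t' != 0 \/ second_cubic f g h s' t' != 0.
  have [z|] := eqVneq (base_cubic s' t') 0; last by left.
  right; apply/eqP => z'; have [s0 t0] := pencil_coprime f0 g0 h0 z z'.
  by case/eqP: w; rewrite s0 t0; ring.
have [a0 b0] : a = 0 /\ b = 0.
  apply: (lform2_eq0 w); first by rewrite -[RHS]E /a /b; ring.
  case: s't'0 => n; apply: (mulIf n); rewrite mul0r.
    rewrite -[RHS](mul0r (base_cubic s t)) -E' /a /b.
    apply/eqP; rewrite -subr_eq0; apply/eqP.
    transitivity ((diag2 v * s' - diag1 v * t') *
      (second_cubic f g h s t * base_cubic s' t'
       - base_cubic s t * second_cubic f g h s' t')).
      by ring.
    by rewrite e subrr mulr0.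
  rewrite -[RHS](mul0r (second_cubic f g h s t)) -E' /a /b.
  apply/eqP; rewrite -subr_eq0; apply/eqP.
  transitivity ((base_coef_s v * s' + base_coef_t v * t') *
    (base_cubic s t * second_cubic f g h s' t'
     - second_cubic f g h s t * base_cubic s' t')).
    by ring.
  by rewrite e subrr mulr0.
rewrite /discriminant; case: st0 => n; apply: (mulIf n); rewrite mul0r.
  transitivity (diag2 v * b - (- diag1 v) * a); first by rewrite /a /b; ring.
  by rewrite a0 b0 !mulr0 subrr.
transitivity (a * base_coef_t v - b * base_coef_s v); first by rewrite /a /b; ring.
by rewrite a0 b0 !mul0r subrr.
Qed.

(** When the two linear coefficients of [confocal_cone] satisfy a linear
    relation, the roots of the matching member of the pencil are zeros of
    [confocal]. The second conclusion serves to exclude the base triangle when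
    [P] is one of its vertices: a point with [Y2 = 0] on the cone is a vertex
    of that triangle. *)
Lemma pencil_vertex v X c s t l m :
  X <> 0 -> c != 0 -> Y1 X = c * (t * - (s + t)) ->
  Y2 X = c * (- (s + t) * s) -> Y3 X = c * (s * t) ->
  (l != 0) || (m != 0) -> l * diag2 v + m * base_coef_s v = 0 ->
  l * - diag1 v + m * base_coef_t v = 0 ->
  m * second_cubic f g h s t = l * base_cubic s t ->
  confocal v X = 0 /\ (diag2 v != 0 -> Y2 X != 0).
Proof.
move=> X0 c0 h1 h2 h3 lm e1 e2 e; split.
  have [l0|m0] := orP lm.
    apply: (mulfI (_ : 2 * l != 0)); first by rewrite mulf_neq0 ?pnatr_eq0.
    rewrite mulr0 mulrAC (confocal_cone v h1 h2 h3).
    transitivity (c ^+ 2 * (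
      (l * diag2 v + m * base_coef_s v) * s * second_cubic f g h s t
      + (l * - diag1 v + m * base_coef_t v) * t * second_cubic f g h s t
      - (base_coef_s v * s + base_coef_t v * t) *
        (m * second_cubic f g h s t - l * base_cubic s t))); first by ring.
    by rewrite e1 e2 e subrr; ring.
  apply: (mulfI (_ : 2 * m != 0)); first by rewrite mulf_neq0 ?pnatr_eq0.
  rewrite mulr0 mulrAC (confocal_cone v h1 h2 h3).
  transitivity (c ^+ 2 * ((l * diag2 v + m * base_coef_s v) * s * base_cubic s t
    + (l * - diag1 v + m * base_coef_t v) * t * base_cubic s t
    + (diag2 v * s - diag1 v * t) *
      (m * second_cubic f g h s t - l * base_cubic s t))); first by ring.
  by rewrite e1 e2 e subrr; ring.
move=> d20; apply/eqP; rewrite h2 => /eqP.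
rewrite mulf_eq0 (negbTE c0) /= => /eqP rs.
have z : base_cubic s t = 0 by rewrite /base_cubic -[RHS](mulr0 t) -rs; ring.
have z' : second_cubic f g h s t != 0.
  apply/eqP => z'; have [s0 t0] := pencil_coprime f0 g0 h0 z z'.
  by apply: X0; apply: Yinj; rewrite linear_form0 ?h1 ?h2 ?h3 // s0 t0; ring.
have m0 : m = 0 by apply: (mulIf z'); rewrite e z mulr0 mul0r.
move: lm e1; rewrite m0 eqxx orbF mul0r addr0 => l0 /eqP.
by rewrite mulf_eq0 (negbTE l0) (negbTE d20).
Qed.

(** One real root of the cubic suffices: the porism supplies a triangle with
    that vertex, and its other two vertices are roots of the same cubic by
    [param_polar]. *)
Lemma discriminant_frame v : discriminant v = 0 -> exists X Y Z,
  [/\ porism (X, Y, Z),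
      [/\ confocal v X = 0, confocal v Y = 0 & confocal v Z = 0] &
      diag2 v != 0 -> [/\ Y2 X != 0, Y2 Y != 0 & Y2 Z != 0]].
Proof.
move=> /det2_eq0[l [m [lm e1 e2]]].
have [s [t [st0 root]]] : exists s t, (s != 0) || (t != 0) /\
    m * second_cubic f g h s t = l * base_cubic s t.
  have [s [t [st0 root]]] := cubic_root (2 * g * m) (m * (3 * g + h - f) + l)
    (m * (g - h - 3 * f) + l) (- 2 * f * m).
  exists s, t; split=> //; apply/eqP; rewrite -subr_eq0 -[X in _ == X]root.
  by apply/eqP; rewrite /second_cubic /base_cubic /=; ring.
have [X0 [h1 h2 h3]] := Ysurj (t * - (s + t)) (- (s + t) * s) (s * t).
have X0n : X0 <> 0.
  move=> e; move: h1 h2 h3; rewrite e !linear_form0 // => h1 h2 h3.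
  have s0 : s = 0.
    apply/eqP; rewrite -sqrf_eq0; apply/eqP.
    transitivity (- (- (s + t) * s) - s * t); first by ring.
    by rewrite -h2 -h3 subr0 oppr0.
  have t0 : t = 0.
    apply/eqP; rewrite -sqrf_eq0; apply/eqP.
    transitivity (- (t * - (s + t)) - s * t); first by ring.
    by rewrite -h1 -h3 subr0 oppr0.
  by move: st0; rewrite s0 t0 eqxx.
have cX0 : cone X0 by rewrite /cone h1 h2 h3; ring.
have [c [Y [Z [c0 tri]]]] := porism_vertex X0n cX0.
pose X := c *: X0; rewrite -/X in tri.
have [[Xn Yn Zn] [cX cY cZ] [oXY oYZ oZX]] := porism_frame tri.
have k1 : Y1 X = c * (t * - (s + t)) by rewrite linear_form_scale // h1.
have k2 : Y2 X = c * (- (s + t) * s) by rewrite linear_form_scale // h2.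
have k3 : Y3 X = c * (s * t) by rewrite linear_form_scale // h3.
have [vX nX] := pencil_vertex Xn c0 k1 k2 k3 lm e1 e2 root.
have other W : W <> 0 -> cone W -> polar X W = 0 ->
    confocal v W = 0 /\ (diag2 v != 0 -> Y2 W != 0).
  move=> Wn cW oXW.
  have [c' [s' [t' [c'0 k1' k2' k3']]]] := cone_paramP Wn cW.
  have [w e] := param_polar Xn Wn oXW c0 c'0 k1 k2 k3 k1' k2' k3'.
  apply: (pencil_vertex Wn c'0 k1' k2' k3' lm e1 e2).
  have [z|z] := eqVneq (base_cubic s t) 0; last first.
    apply: (mulfI z); apply/eqP; rewrite -subr_eq0; apply/eqP.
    transitivity (m * (base_cubic s t * second_cubic f g h s' t')
      - l * base_cubic s t * base_cubic s' t'); first by ring.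
    by rewrite e -root; ring.
  have z' : second_cubic f g h s t != 0.
    apply/eqP => z'; have [s0 t0] := pencil_coprime f0 g0 h0 z z'.
    by case/eqP: w; rewrite s0 t0; ring.
  apply: (mulfI z'); apply/eqP; rewrite -subr_eq0; apply/eqP.
  transitivity (m * second_cubic f g h s t * second_cubic f g h s' t'
    - l * (second_cubic f g h s t * base_cubic s' t')); first by ring.
  by rewrite -e root; ring.
have [vY nY] := other _ Yn cY oXY.
have [vZ nZ] : confocal v Z = 0 /\ (diag2 v != 0 -> Y2 Z != 0).
  by apply: other => //; rewrite polarC.
by exists X, Y, Z; split=> // d20; split; [exact: nX|exact: nY|exact: nZ].
Qed.

(** The Gram determinant of a frame is [f g h] times the square of the
    determinant [D] of its coordinates, so [D] is nonzero. *)
Lemma frame_eq0 X Y Z w : polar_frame X Y Z ->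
  polar X w = 0 -> polar Y w = 0 -> polar Z w = 0 -> w = 0.
Proof.
move=> [[Xn Yn Zn] _ [oXY oYZ oZX]] hX hY hZ.
pose D := Y1 X * (Y2 Y * Y3 Z - Y3 Y * Y2 Z) - Y2 X * (Y1 Y * Y3 Z - Y3 Y * Y1 Z)
  + Y3 X * (Y1 Y * Y2 Z - Y2 Y * Y1 Z).
have D0 : D != 0.
  apply/eqP => D0.
  have : polar X X * polar Y Y * polar Z Z = 0.
    transitivity (f * g * h * D ^+ 2 + polar X X * polar Y Z ^+ 2
      + polar Y Y * polar Z X ^+ 2 + polar Z Z * polar X Y ^+ 2
      - 2 * polar X Y * polar Y Z * polar Z X).
      by rewrite /D /polar /polar_form; ring.
    by rewrite D0 oXY oYZ oZX; ring.
  by apply/eqP; rewrite !mulf_neq0 // lt0r_neq0 // polar_gt0.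
apply: Yinj; rewrite linear_form0 //.
- apply: (mulfI (mulf_neq0 (lt0r_neq0 f0) D0)); rewrite mulr0.
  transitivity (polar X w * (Y2 Y * Y3 Z - Y3 Y * Y2 Z)
    + polar Y w * (Y2 Z * Y3 X - Y3 Z * Y2 X)
    + polar Z w * (Y2 X * Y3 Y - Y3 X * Y2 Y)).
    by rewrite /D /polar /polar_form; ring.
  by rewrite hX hY hZ; ring.
- apply: (mulfI (mulf_neq0 (lt0r_neq0 g0) D0)); rewrite mulr0.
  transitivity (polar X w * (Y3 Y * Y1 Z - Y1 Y * Y3 Z)
    + polar Y w * (Y3 Z * Y1 X - Y1 Z * Y3 X)
    + polar Z w * (Y3 X * Y1 Y - Y1 X * Y3 Y)).
    by rewrite /D /polar /polar_form; ring.
  by rewrite hX hY hZ; ring.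
- apply: (mulfI (mulf_neq0 (lt0r_neq0 h0) D0)); rewrite mulr0.
  transitivity (polar X w * (Y1 Y * Y2 Z - Y2 Y * Y1 Z)
    + polar Y w * (Y1 Z * Y2 X - Y2 Z * Y1 X)
    + polar Z w * (Y1 X * Y2 Y - Y2 X * Y1 Y)).
    by rewrite /D /polar /polar_form; ring.
  by rewrite hX hY hZ; ring.
Qed.

Lemma frame_expand X Y Z w : polar_frame X Y Z ->
  w = (polar X w / polar X X) *: X + (polar Y w / polar Y Y) *: Y
    + (polar Z w / polar Z Z) *: Z.
Proof.
move=> fr; have [[Xn Yn Zn] _ [oXY oYZ oZX]] := fr.
have nX := lt0r_neq0 (polar_gt0 Xn); have nY := lt0r_neq0 (polar_gt0 Yn).
have nZ := lt0r_neq0 (polar_gt0 Zn).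
apply/eqP; rewrite -subr_eq0; apply/eqP; rewrite -scaleN1r.
apply: (frame_eq0 fr); rewrite !(polarD, polarZ).
- by rewrite oXY (polarC X Z) oZX; field; rewrite nX nY nZ.
- by rewrite oYZ (polarC Y X) oXY; field; rewrite nX nY nZ.
- by rewrite oZX (polarC Z Y) oYZ; field; rewrite nX nY nZ.
Qed.

Lemma frame_parseval X Y Z v w : polar_frame X Y Z ->
  polar v w = polar X v * polar X w / polar X X
    + polar Y v * polar Y w / polar Y Y + polar Z v * polar Z w / polar Z Z.
Proof.
move=> fr; rewrite {1}(frame_expand w fr) !(polarD, polarZ).
by rewrite (polarC v X) (polarC v Y) (polarC v Z); ring.
Qed.

Lemma frame_third X Y Z w : polar_frame X Y Z ->
  polar X w = 0 -> polar Y w = 0 -> exists c, w = c *: Z.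
Proof.
move=> fr hX hY; exists (polar Z w / polar Z Z).
by rewrite {1}(frame_expand w fr) hX hY !mul0r !scale0r !add0r.
Qed.

Lemma polar_frame_rot X Y Z : polar_frame X Y Z -> polar_frame Y Z X.
Proof. by move=> [[? ? ?] [? ? ?] [? ? ?]]. Qed.

(** The three proportionality conditions determine the common factor: divided
    by the squared lengths of the vertices they add up to [polar P v = k *
    trace]. *)
Lemma confocal_iff_proportional X Y Z v : polar_frame X Y Z ->
  (confocal v X = 0 /\ confocal v Y = 0 /\ confocal v Z = 0) <->
  exists k, [/\ polar X P * polar X v = k * (polar X I ^+ 2 + polar X J ^+ 2),
    polar Y P * polar Y v = k * (polar Y I ^+ 2 + polar Y J ^+ 2) &
    polar Z P * polar Z v = k * (polar Z I ^+ 2 + polar Z J ^+ 2)].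
Proof.
move=> fr; split=> [[cX [cY cZ]]|[k [kX kY kZ]]].
  by exists (confocal_ratio v); split; apply/eqP; rewrite -subr_eq0; apply/eqP.
suff kE : k = confocal_ratio v by rewrite /confocal -kE kX kY kZ !subrr.
apply: (mulIf (lt0r_neq0 trace_gt0)).
rewrite /confocal_ratio mulfVK ?(lt0r_neq0 trace_gt0) // (frame_parseval P v fr) kX kY kZ.
by rewrite /trace (frame_parseval I I fr) (frame_parseval J J fr); ring.
Qed.

(** With a zero ratio the conditions read [polar X P * polar X v = 0] at each
    vertex [X]; two factors involving [P] cannot vanish unless [P] is the
    third vertex, so two factors involving [v] do. *)
Lemma zero_ratio_vertex v X Y Z : polar_frame X Y Z ->
  (forall c, P <> c *: X) -> (forall c, P <> c *: Y) -> (forall c, P <> c *: Z) ->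
  confocal v X = 0 -> confocal v Y = 0 -> confocal v Z = 0 ->
  polar P v = 0 ->
  [\/ exists c, v = c *: X, exists c, v = c *: Y | exists c, v = c *: Z].
Proof.
move=> fr nX nY nZ; rewrite /confocal /confocal_ratio => + + + Pv.
rewrite Pv !mul0r !subr0 => /eqP + /eqP + /eqP.
rewrite !mulf_eq0.
have fr' := polar_frame_rot fr; have fr'' := polar_frame_rot fr'.
have tX : polar Y P = 0 -> polar Z P = 0 -> False.
  by move=> h1 h2; have [c] := frame_third fr' h1 h2; exact: nX.
have tY : polar Z P = 0 -> polar X P = 0 -> False.
  by move=> h1 h2; have [c] := frame_third fr'' h1 h2; exact: nY.
have tZ : polar X P = 0 -> polar Y P = 0 -> False.
  by move=> h1 h2; have [c] := frame_third fr h1 h2; exact: nZ.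
move=> /orP[]/eqP hX /orP[]/eqP hY /orP[]/eqP hZ.
- by case: (tZ hX hY).
- by case: (tZ hX hY).
- by case: (tY hZ hX).
- by apply: Or31; exact: (frame_third fr').
- by case: (tX hY hZ).
- by apply: Or32; exact: (frame_third fr'').
- by apply: Or33; exact: (frame_third fr).
- by apply: Or33; exact: (frame_third fr).
Qed.

Lemma linear_form_confocal_ratio : linear_form confocal_ratio.
Proof. by apply: linear_formZr; exact: linear_form_polar. Qed.

Lemma linear_form_coef Ya Yb : linear_form Ya -> linear_form Yb ->
  linear_form (entry Ya Yb).
Proof.
move=> ha hb; apply: linear_formD.
  by apply: linear_formZr; apply: linear_formD; exact: linear_formZ.
by apply: linear_formN; apply: linear_formZr; exact: linear_form_confocal_ratio.
Qed.

Lemma linear_form_diag1 : linear_form diag1.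
Proof. by apply: linear_formZ; exact: linear_form_coef. Qed.
Lemma linear_form_diag2 : linear_form diag2.
Proof. by apply: linear_formZ; exact: linear_form_coef. Qed.
Lemma linear_form_diag3 : linear_form diag3.
Proof. by apply: linear_formZ; exact: linear_form_coef. Qed.

Local Hint Resolve linear_form_diag1 linear_form_diag2 linear_form_diag3 : core.

Lemma linear_form_L0s : linear_form base_coef_s.
Proof.
apply: linear_formD; last apply: linear_formN.
  apply: linear_formZ; apply: linear_formD; last apply: linear_formN.
    by apply: linear_formZ; exact: linear_form_coef.
  by apply: linear_formZ; exact: linear_form_coef.
do 2 (apply: linear_formD; last exact: linear_formZ).
apply: linear_formD; last by apply: linear_formN; exact: linear_formZ.
by apply: linear_formD; [|apply: linear_formN]; exact: linear_formZ.
Qed.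

Lemma linear_form_L0t : linear_form base_coef_t.
Proof.
apply: linear_formD; last apply: linear_formN.
  apply: linear_formZ; apply: linear_formD; last apply: linear_formN.
    by apply: linear_formZ; exact: linear_form_coef.
  by apply: linear_formZ; exact: linear_form_coef.
apply: linear_formD; last by apply: linear_formN; exact: linear_formZ.
apply: linear_formD; last apply: linear_formN; apply: linear_formZ.
  by apply: linear_formD => //; exact: linear_formZ.
exact: linear_formD.
Qed.

(** The quadratic form is not zero because some [v] is left out of the locus:
    by [zero_ratio_vertex] any point of the polar line of [P] that is off the
    cone will do. *)
Lemma frame_locus_off_cone : ~ cone P -> is_conic frame_locus.
Proof.
move=> nP.
have locE : frame_locus =
    [set v | v <> 0 /\ diag2 v * base_coef_t v - - diag1 v * base_coef_s v = 0].
  apply/seteqP; split=> v [v0].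
    move=> [X [Y [Z [tri _ [vX vY _]]]]]; split=> //.
    have [[Xn Yn _] [cX cY _] [o _ _]] := porism_frame tri.
    exact: (frame_discriminant Xn Yn cX cY o).
  move=> /discriminant_frame[X [Y [Z [tri [vX vY vZ] _]]]].
  split=> //; exists X, Y, Z; split=> //.
  have [_ [cX cY cZ] _] := porism_frame tri.
  have nc W c : cone W -> P <> c *: W.
    move=> cW e; apply: nP; rewrite e /cone !linear_form_scale //.
    by transitivity (c ^+ 2 * 0); [rewrite -cW; ring|rewrite mulr0].
  by split=> c; exact: nc.
have [M [MT ME]] := quadric_of_forms linear_form_diag2 linear_form_L0t
  (linear_formN linear_form_diag1) linear_form_L0s.
split.
  have [v [h1 h2 h3]] := Ysurj (Y2 P * Y3 P * (Y1 I ^+ 2 + Y1 J ^+ 2))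
    (Y3 P * Y1 P * (Y2 I ^+ 2 + Y2 J ^+ 2)) (Y1 P * Y2 P * (Y3 I ^+ 2 + Y3 J ^+ 2)).
  exists v; rewrite locE /=; split.
    move=> v0; move: h1 h2 h3; rewrite v0 !linear_form0 // => h1 h2 h3.
    apply: nP; rewrite /cone.
    have z1 : Y2 P * Y3 P = 0 by apply: (mulIf (lt0r_neq0 N11)); rewrite -h1 mul0r.
    have z2 : Y3 P * Y1 P = 0 by apply: (mulIf (lt0r_neq0 N22)); rewrite -h2 mul0r.
    have z3 : Y1 P * Y2 P = 0 by apply: (mulIf (lt0r_neq0 N33)); rewrite -h3 mul0r.
    by rewrite z1 z2 z3 !addr0.
  have r : confocal_ratio v = Y1 P * Y2 P * Y3 P.
    apply: (mulIf (lt0r_neq0 trace_gt0)).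
    rewrite /confocal_ratio mulfVK ?(lt0r_neq0 trace_gt0) //.
    by rewrite /trace /polar /polar_form h1 h2 h3; ring.
  have -> : diag1 v = 0 by rewrite /diag1 /entry r h1; field.
  have -> : diag2 v = 0 by rewrite /diag2 /entry r h2; field.
  by ring.
left; exists M; split=> //; last by rewrite locE ME.
move=> M0.
have all_in v : v <> 0 -> frame_locus v.
  move=> v0; rewrite locE -ME M0; split=> //=.
  by rewrite mulmx0 mul0mx.
have [v [v0 Pv nv]] : exists v, [/\ v <> 0, polar P v = 0 & ~ cone v].
  have pick x1 x2 x3 : f * Y1 P * x1 + g * Y2 P * x2 + h * Y3 P * x3 = 0 ->
      x2 * x3 + x3 * x1 + x1 * x2 <> 0 ->
      exists v, [/\ v <> 0, polar P v = 0 & ~ cone v].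
    move=> e n; have [v [h1 h2 h3]] := Ysurj x1 x2 x3; exists v.
    have nv : ~ cone v by rewrite /cone h1 h2 h3.
    split=> //; last by rewrite /polar /polar_form h1 h2 h3.
    by move=> v0; apply: nv; rewrite v0 /cone !linear_form0 //; ring.
  have [z1|z1] := eqVneq (Y2 P * Y3 P) 0; last first.
    apply: (pick 0 (- (h * Y3 P)) (g * Y2 P)); first by ring.
    have -> : - (h * Y3 P) * (g * Y2 P) + g * Y2 P * 0 + 0 * (- (h * Y3 P)) =
      - (g * h * (Y2 P * Y3 P)) by ring.
    by apply/eqP; rewrite oppr_eq0 mulf_neq0 // mulf_neq0 // lt0r_neq0.
  have [z2|z2] := eqVneq (Y3 P * Y1 P) 0; last first.
    apply: (pick (- (h * Y3 P)) 0 (f * Y1 P)); first by ring.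
    have -> : 0 * (f * Y1 P) + f * Y1 P * - (h * Y3 P) + - (h * Y3 P) * 0 =
      - (f * h * (Y3 P * Y1 P)) by ring.
    by apply/eqP; rewrite oppr_eq0 mulf_neq0 // mulf_neq0 // lt0r_neq0.
  have [z3|z3] := eqVneq (Y1 P * Y2 P) 0; last first.
    apply: (pick (- (g * Y2 P)) (f * Y1 P) 0); first by ring.
    have -> : f * Y1 P * 0 + 0 * - (g * Y2 P) + - (g * Y2 P) * (f * Y1 P) =
      - (f * g * (Y1 P * Y2 P)) by ring.
    by apply/eqP; rewrite oppr_eq0 mulf_neq0 // mulf_neq0 // lt0r_neq0.
  by case: nP; rewrite /cone z1 z2 z3 !addr0.
have [_ [X [Y [Z [tri [nX nY nZ] [vX vY vZ]]]]]] := all_in v v0.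
have fr := porism_frame tri; have [_ [cX cY cZ] _] := fr.
have cone_scale c W : cone W -> cone (c *: W).
  move=> cW; rewrite /cone !linear_form_scale //.
  by transitivity (c ^+ 2 * 0); [rewrite -cW; ring|rewrite mulr0].
by case: (zero_ratio_vertex fr nX nY nZ vX vY vZ Pv) => -[c e]; apply: nv; rewrite e;
  exact: cone_scale.
Qed.

(** Here [P] is the first vertex of the base triangle. The diagonal entries,
    and hence the discriminant, are divisible by [confocal_ratio], which
    vanishes on the side opposite to [P]; the other factor [l] is the equation
    of the line, and [w] is its point on that side. *)
Lemma frame_locus_at_vertex : Y2 P = 0 -> Y3 P = 0 -> is_conic frame_locus.
Proof.
move=> P2 P3.
have P1 : Y1 P != 0.
  by apply/eqP => P1; apply: P0; apply: Yinj; rewrite linear_form0.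
have polarP v : polar v P = f * Y1 v * Y1 P.
  by rewrite /polar /polar_form P2 P3; ring.
have tr0 := lt0r_neq0 trace_gt0.
have ratio0 v : (confocal_ratio v == 0) = (Y1 v == 0).
  rewrite /confocal_ratio polarC polarP mulf_eq0 invr_eq0 (negbTE tr0) orbF.
  by rewrite !mulf_eq0 (negbTE P1) (gt_eqF f0) orbF.
pose N1 := Y1 I ^+ 2 + Y1 J ^+ 2; pose N2 := Y2 I ^+ 2 + Y2 J ^+ 2.
pose N3 := Y3 I ^+ 2 + Y3 J ^+ 2.
have traceE : trace = f * N1 + g * N2 + h * N3.
  by rewrite /trace /polar /polar_form /N1 /N2 /N3; ring.
pose l v := - (g * N2) * base_coef_t v + (g * N2 + h * N3) * base_coef_s v.
have llin : linear_form l.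
  apply: linear_formD; apply: linear_formZ;
  [exact: linear_form_L0t|exact: linear_form_L0s].
have d2E v : diag2 v = - (g * N2) * confocal_ratio v.
  by rewrite /diag2 /entry P2 /N2; ring.
have discE v : discriminant v = confocal_ratio v * l v.
  have d1E : diag1 v = (g * N2 + h * N3) * confocal_ratio v.
    have : f * Y1 P * Y1 v = confocal_ratio v * trace.
      by rewrite /confocal_ratio mulfVK // polarC polarP; ring.
    rewrite traceE => e; rewrite /diag1 /entry -/N1.
    transitivity (f * Y1 P * Y1 v - f * N1 * confocal_ratio v);
      first by rewrite /N1; field.
    by rewrite e; ring.
  by rewrite /discriminant d1E d2E /l; ring.
have l_inf v : Y1 v = 0 -> l v = - 2 * f * g * h * Y1 P * (N2 * Y3 v + N3 * Y2 v).
  move=> v1; have r0 : confocal_ratio v = 0 by apply/eqP; rewrite ratio0 v1.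
  rewrite /l /base_coef_s /base_coef_t /diag1 /diag2 /diag3 /entry r0 P2 P3 v1.
  by field.
have [v0 [v01 v02 v03]] := Ysurj 0 0 1.
have lv0 : l v0 != 0.
  rewrite l_inf // v02 v03 mulr1 mulr0 addr0 !mulf_neq0 ?oppr_eq0 ?pnatr_eq0 //;
  exact: lt0r_neq0.
have [e1 [e11 e12 e13]] := Ysurj 1 0 0.
have [w [w1 w2 w3]] := Ysurj 0 N2 (- N3).
have N20 : N2 != 0 by exact: lt0r_neq0.
have lw : l w = 0 by rewrite l_inf // w2 w3; ring.
have prop_w v : Y1 v = 0 -> l v = 0 -> exists k, v = k *: w.
  move=> v1 lv; exists (Y2 v / N2).
  have e : N2 * Y3 v + N3 * Y2 v = 0.
    apply: (mulfI (_ : - 2 * f * g * h * Y1 P != 0)); last by rewrite -l_inf // mulr0.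
    by rewrite !mulf_neq0 ?oppr_eq0 ?pnatr_eq0 //; exact: lt0r_neq0.
  apply: Yinj; rewrite linear_form_scale // ?w1 ?w2 ?w3 ?v1 ?mulr0 ?mulfVK //.
  apply: (mulfI N20); apply/eqP; rewrite -subr_eq0 -[X in _ == X]e; apply/eqP.
  by field.
have [cl clE] := llin.
have locE : frame_locus = punctured_line cl w.
  apply/seteqP; split=> v.
    move=> [vn [X [Y [Z [tri [nX nY nZ] [vX vY vZ]]]]]].
    have fr := porism_frame tri.
    have [[Xn Yn Zn] [cX cY cZ] [oXY oYZ oZX]] := fr.
    (* With a zero ratio, [v] would be a vertex lying on the side opposite to [P],
       hence a base vertex, and its triangle would have [P] as a vertex. *)
    have r0 : confocal_ratio v != 0.
      rewrite ratio0; apply/eqP => v1.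
      have Pv : polar P v = 0 by rewrite polarC polarP v1; ring.
      have bad A B C : polar_frame A B C -> (forall c, P <> c *: A) ->
          (forall c, P <> c *: B) -> (forall c, P <> c *: C) ->
          ~ exists c, v = c *: C.
        move=> fr' nA nB nC [c vc].
        have [[An Bn Cn] [cA cB cC] [oAB oBC oCA]] := fr'.
        have c0 : c != 0 by apply/eqP => c0; apply: vn; rewrite vc c0 scale0r.
        have C1 : Y1 C = 0.
          by apply: (mulfI c0); rewrite mulr0 -linear_form_scale // -vc.
        have not_P D : D <> 0 -> (forall c, P <> c *: D) -> Y2 D = 0 -> Y3 D <> 0.
          move=> Dn nD D2 D3.
          have D1 : Y1 D != 0.
            by apply/eqP => D1; apply: Dn; apply: Yinj; rewrite linear_form0.
          apply: (nD (Y1 P / Y1 D)); apply: Yinj; rewrite linear_form_scale //.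
          - by rewrite mulfVK.
          - by rewrite D2 P2 mulr0.
          - by rewrite D3 P3 mulr0.
        have two0 : Y1 A = 0 -> Y1 B = 0 -> False.
          move=> A1 B1; have [] := @frame_third _ _ _ P fr'.
          - by rewrite polarP A1; ring.
          - by rewrite polarP B1; ring.
          - exact: nC.
        have C23 : Y2 C * Y3 C = 0 by rewrite -cC C1; ring.
        have vert D : D <> 0 -> (forall c, P <> c *: D) -> cone D -> polar D C = 0 ->
            Y1 D = 0.
          move=> Dn nD cD; rewrite /polar /polar_form C1 mulr0 add0r => o.
          move: C23 => /eqP; rewrite mulf_eq0 => /orP[]/eqP z.
            have C3 : Y3 C != 0.
              by apply/eqP => C3; apply: Cn; apply: Yinj; rewrite linear_form0.
            have D3 : Y3 D = 0.
              apply: (mulIf C3); apply: (mulfI (lt0r_neq0 h0)).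
              by rewrite mul0r mulr0 mulrA -[RHS]o z; ring.
            move: cD; rewrite /cone D3 mulr0 mul0r !add0r => /eqP.
            rewrite mulf_eq0 => /orP[]/eqP // D2.
            by case: (not_P D Dn nD D2 D3).
          have C2 : Y2 C != 0.
            by apply/eqP => C2; apply: Cn; apply: Yinj; rewrite linear_form0.
          have D2 : Y2 D = 0.
            apply: (mulIf C2); apply: (mulfI (lt0r_neq0 g0)).
            by rewrite mul0r mulr0 mulrA -[RHS]o z; ring.
          move: cD; rewrite /cone D2 mulr0 mul0r add0r addr0 => /eqP.
          rewrite mulf_eq0 => /orP[]/eqP // D3.
          by case: (not_P D Dn nD D2 D3).
        by apply: two0; apply: vert => //; rewrite polarC.
      have fr' := polar_frame_rot fr.
      case: (zero_ratio_vertex fr nX nY nZ vX vY vZ Pv) => b.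
      - exact: (bad _ _ _ fr' nY nZ nX).
      - exact: (bad _ _ _ (polar_frame_rot fr') nZ nX nY).
      - exact: (bad _ _ _ fr nX nY nZ).
    split.
      have : discriminant v = 0 by exact: (frame_discriminant Xn Yn cX cY oXY).
      rewrite discE => /eqP; rewrite mulf_eq0 (negbTE r0) /= clE => /eqP e.
      by apply/matrixP => i j; rewrite !ord1 e mxE.
    move=> [k vk]; move/eqP: r0; apply; apply/eqP.
    by rewrite ratio0 vk linear_form_scale // w1 mulr0.
  move=> [lv nw].
  have lv' : l v = 0 by rewrite clE lv mxE.
  have r0 : confocal_ratio v != 0.
    by rewrite ratio0; apply/eqP => v1; apply: nw; exact: prop_w.
  have vn : v <> 0 by move=> v0'; apply: nw; exists 0; rewrite scale0r.
  have [X [Y [Z [tri [vX vY vZ] ne]]]] : exists X Y Z, [/\ porism (X, Y, Z),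
      [/\ confocal v X = 0, confocal v Y = 0 & confocal v Z = 0] &
      diag2 v != 0 -> [/\ Y2 X != 0, Y2 Y != 0 & Y2 Z != 0]].
    by apply: discriminant_frame; rewrite discE lv' mulr0.
  have [] := ne; first by rewrite d2E mulf_neq0 // oppr_eq0 mulf_neq0 // lt0r_neq0.
  have np W : Y2 W != 0 -> forall c, P <> c *: W.
    move=> W2 c e; apply: P0; rewrite e; have [->|c0] := eqVneq c 0.
      by rewrite scale0r.
    by case/eqP: W2; apply: (mulfI c0); rewrite mulr0 -linear_form_scale // -e.
  move=> X2 Y2n Z2; split=> //; exists X, Y, Z; split=> //.
  by split; exact: np.
split; last first.
  right; exists cl, w; split=> //.
  - by move=> c0; move/eqP: lv0; rewrite clE c0 mulmx0 mxE.
  - move=> w0; move: w2; rewrite w0 linear_form0 // => /eqP.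
    by rewrite eq_sym (negbTE N20).
  - by apply/matrixP => i j; rewrite !ord1 -clE lw mxE.
exists (e1 + (- (l e1 / l v0)) *: v0); rewrite locE; split.
  apply/matrixP => i j; rewrite !ord1 -clE mxE.
  rewrite linear_form_add ?linear_form_scale; [|by exists cl..].
  by field.
move=> [k /(congr1 Y1)].
rewrite linear_form_add // !linear_form_scale // e11 v01 w1 !mulr0 addr0 => /eqP.
by rewrite oner_eq0.
Qed.

End Locus.

(** * Isogonal conjugates through areas *)

Section Isogonal.
Variable R : realType.
Implicit Types (A B C P X Y d u r : 'rV[R]_2) (v : 'rV[R]_(2 + 1)).

Definition cross X Y : R := abscissa X * ordinate Y - ordinate X * abscissa Y.

Lemma dot_gt0 X : X <> 0 -> 0 < dot X X.
Proof.
move=> X0; rewrite lt0r dotE -!expr2 addr_ge0 ?sqr_ge0 // andbT.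
rewrite paddr_eq0 ?sqr_ge0 // !sqrf_eq0; apply/negP => /andP[/eqP h0 /eqP h1].
by apply: X0; apply: eq_plane; rewrite ?h0 ?h1 /abscissa /ordinate mxE.
Qed.

(** Reflection about the bisector of [u] and [w] exchanges these two vectors
    of equal length and reverses orientation. *)
Lemma reflect_cross u (w : 'rV[R]_2) d : dot u u = dot w w -> u + w <> 0 ->
  cross u (reflect_dir (u + w) d) = - cross w d.
Proof.
move=> uw /dot_gt0/lt0r_neq0 b0; rewrite /reflect_dir.
set k := _ / _; have kE : k * dot (u + w) (u + w) = 2 * dot d (u + w).
  by rewrite /k mulfVK.
apply: (mulIf b0); apply/eqP; rewrite -subr_eq0; apply/eqP.
transitivity ((k * dot (u + w) (u + w)) * cross u w
   - dot (u + w) (u + w) * cross (u - w) d).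
  by rewrite /cross !planeE; ring.
rewrite kE; transitivity ((dot u u - dot w w) * cross d (u + w)).
  by rewrite /cross !planeE; ring.
by rewrite uw subrr mul0r.
Qed.

Lemma cross_reflect_eq0 u (w : 'rV[R]_2) d X : dot u u = dot w w -> cross u w != 0 ->
  cross (reflect_dir (u + w) d) X = 0 <->
  cross u d * cross u X = cross w d * cross w X.
Proof.
move=> uw c0; have b0 : u + w <> 0.
  move=> e; move/eqP: c0; apply; have -> : w = - u.
    by apply/eqP; rewrite -addr_eq0 addrC e.
  by rewrite /cross !planeE; ring.
have ru := reflect_cross d uw b0.
have rw : cross w (reflect_dir (u + w) d) = - cross u d.
  by rewrite addrC; apply: reflect_cross => //; rewrite addrC.
move: ru rw; set r := reflect_dir _ _ => ru rw.
have E : cross u w * cross r X = cross u d * cross u X - cross w d * cross w X.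
  transitivity (cross u r * cross w X - cross u X * cross w r).
    by rewrite /cross; ring.
  by rewrite ru rw; ring.
split=> [e|e].
  by apply/eqP; rewrite -subr_eq0 -E e mulr0.
by apply: (mulfI c0); rewrite E e subrr mulr0.
Qed.

Lemma reflect_neq0 u (w : 'rV[R]_2) d : dot u u = dot w w -> cross u w != 0 -> d <> 0 ->
  reflect_dir (u + w) d <> 0.
Proof.
move=> uw c0 d0 r0; apply: d0.
have h X : cross u d * cross u X = cross w d * cross w X.
  by apply/(cross_reflect_eq0 d X uw c0); rewrite r0 /cross /abscissa /ordinate
    !mxE; ring.
have cu : cross u d = 0.
  by apply: (mulIf c0); rewrite h /cross; ring.
have cw : cross w d = 0.
  apply: (mulIf c0); rewrite mul0r; have := h u.
  by rewrite cu mul0r => e; rewrite -[RHS]oppr0 e /cross; ring.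
apply: eq_plane; apply: (mulfI c0).
  transitivity (abscissa u * cross w d * -1 + abscissa w * cross u d).
    by rewrite /cross; ring.
  by rewrite cu cw /abscissa !mxE; ring.
transitivity (ordinate u * cross w d * -1 + ordinate w * cross u d).
  by rewrite /cross; ring.
by rewrite cu cw /ordinate !mxE; ring.
Qed.

(** A vector of the direction from [A] to [v], multiplied by the weight of [v]
    so that it makes sense for points at infinity too. *)
Definition from_origin v A : 'rV[R]_2 :=
  \row_(j < 2) ((if j == 0 then cx v else cy v) - cw v * A 0 j).

Lemma abscissa_from v A : abscissa (from_origin v A) = cx v - cw v * abscissa A.
Proof. by rewrite /abscissa mxE. Qed.
Lemma ordinate_from v A : ordinate (from_origin v A) = cy v - cw v * ordinate A.
Proof. by rewrite /ordinate mxE. Qed.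

Lemma projective_lineP A r v : r <> 0 ->
  projective_line A r v <-> cross r (from_origin v A) = 0.
Proof.
move=> r0; split=> [[s [t ->]]|e].
  by rewrite /cross abscissa_from ordinate_from !coordE; ring.
have rr := lt0r_neq0 (dot_gt0 r0).
exists (cw v), (dot (from_origin v A) r / dot r r).
apply: eq_space; rewrite !coordE; last by ring.
- apply: (mulfI rr); apply/eqP; rewrite -subr_eq0; apply/eqP.
  transitivity (- ordinate r * cross r (from_origin v A)); last by rewrite e mulr0.
  rewrite /cross !dotE abscissa_from ordinate_from; field.
  by rewrite -dotE.
- apply: (mulfI rr); apply/eqP; rewrite -subr_eq0; apply/eqP.
  transitivity (abscissa r * cross r (from_origin v A)); last by rewrite e mulr0.
  rewrite /cross !dotE abscissa_from ordinate_from; field.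
  by rewrite -dotE.
Qed.

Lemma enormK X : enorm X ^+ 2 = dot X X.
Proof. by rewrite sqr_sqrtr // dotE -!expr2 addr_ge0 ?sqr_ge0. Qed.

(** A point lies on the reflected cevian when its distances to the two sides
    through [A] are inversely proportional to those of [P]; unlike the
    bisector, this involves no square root. *)
Lemma reflected_cevianP A B C P v : cross (B - A) (C - A) != 0 -> P <> A ->
  reflected_cevian A B C P v <->
  dot (C - A) (C - A) * (cross (B - A) (P - A) * cross (B - A) (from_origin v A)) =
  dot (B - A) (B - A) * (cross (C - A) (P - A) * cross (C - A) (from_origin v A)).
Proof.
move=> c0 PA.
have B0 : B - A <> 0.
  by move=> e; move/eqP: c0; apply; rewrite e /cross /abscissa /ordinate !mxE; ring.
have C0 : C - A <> 0.
  by move=> e; move/eqP: c0; apply; rewrite e /cross /abscissa /ordinate !mxE; ring.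
have nz X : X <> 0 -> enorm X != 0.
  by move=> /dot_gt0 X0; rewrite -sqrf_eq0 enormK gt_eqF.
have bn := nz _ B0; have cn := nz _ C0.
rewrite -!enormK.
set b := enorm (B - A) in bn *; set c := enorm (C - A) in cn *.
have unit X : X <> 0 -> dot ((enorm X)^-1 *: X) ((enorm X)^-1 *: X) = 1.
  move=> X0; transitivity ((enorm X)^-1 ^+ 2 * dot X X).
    by rewrite !planeE; ring.
  by rewrite -enormK -exprMn mulVf ?expr1n // nz.
have uw := etrans (unit _ B0) (esym (unit _ C0)).
have crossZ k X Y : cross (k *: X) Y = k * cross X Y.
  by rewrite /cross !planeE; ring.
have crossZr k X Y : cross X (k *: Y) = k * cross X Y.
  by rewrite /cross !planeE; ring.
have c1 : cross (b^-1 *: (B - A)) (c^-1 *: (C - A)) != 0.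
  by rewrite crossZ crossZr !mulf_neq0 ?invr_eq0.
have PA0 : P - A <> 0 by move=> /eqP; rewrite subr_eq0 => /eqP.
rewrite /reflected_cevian /bisector -/b -/c.
rewrite projective_lineP; last exact: reflect_neq0.
rewrite (cross_reflect_eq0 (P - A) (from_origin v A) uw c1) !crossZ -/b -/c.
split=> e.
  apply: (mulfI (_ : (b ^+ 2)^-1 * (c ^+ 2)^-1 != 0)).
    by rewrite mulf_neq0 // invr_eq0 expf_eq0.
  transitivity (b^-1 * cross (B - A) (P - A) *
    (b^-1 * cross (B - A) (from_origin v A))); first by field; rewrite bn.
  by rewrite e; field; rewrite bn cn.
apply: (mulfI (_ : b ^+ 2 * c ^+ 2 != 0)); first by rewrite mulf_neq0 // expf_eq0.
transitivity (c ^+ 2 *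
  (cross (B - A) (P - A) * cross (B - A) (from_origin v A))); first by field.
by rewrite e; field.
Qed.

Definition det3 (x y z : 'rV[R]_(2 + 1)) : R :=
  cx x * (cy y * cw z - cw y * cy z) - cy x * (cx y * cw z - cw y * cx z)
  + cw x * (cx y * cy z - cy y * cx z).

(** For a line with equation [l], the values of [l] at these two infinite
    points are the components of its normal. *)
Definition absolute_x : 'rV[R]_(2 + 1) := infinite_point (delta_mx 0 0).
Definition absolute_y : 'rV[R]_(2 + 1) := infinite_point (delta_mx 0 1).

Lemma absolute_xE : (cx absolute_x = 1) * (cy absolute_x = 0) * (cw absolute_x = 0).
Proof. by rewrite !coordE /abscissa /ordinate !mxE. Qed.
Lemma absolute_yE : (cx absolute_y = 0) * (cy absolute_y = 1) * (cw absolute_y = 0).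
Proof. by rewrite !coordE /abscissa /ordinate !mxE. Qed.

Definition absoluteE := (absolute_xE, absolute_yE).

Definition normal_sq (l : 'rV[R]_(2 + 1) -> R) : R :=
  l absolute_x ^+ 2 + l absolute_y ^+ 2.

(** Each reflected cevian equates two of the three products of distances to a
    side, and two of these equalities imply the third. *)
Lemma isogonal_conjugateP A B C P v :
  let A' := affine_point A in let B' := affine_point B in
  let C' := affine_point C in let P' := affine_point P in
  det3 A' B' C' != 0 ->
  isogonal_conjugate A B C P v <->
  [/\ [/\ P <> A, P <> B & P <> C], v <> 0 & exists k,
    [/\ det3 P' B' C' * det3 v B' C' = k * normal_sq (fun w => det3 w B' C'),
        det3 A' P' C' * det3 A' v C' = k * normal_sq (fun w => det3 A' w C') &
        det3 A' B' P' * det3 A' B' v = k * normal_sq (fun w => det3 A' B' w)]].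
Proof.
move=> A' B' C' P' D0.
have DE : cross (B - A) (C - A) = det3 A' B' C'.
  by rewrite /cross /det3 !planeE !coordE; ring.
have D1 : cross (B - A) (C - A) != 0 by rewrite DE.
have D2 : cross (C - B) (A - B) != 0.
  by move: D1; congr (_ != _); rewrite /cross !planeE; ring.
have D3 : cross (A - C) (B - C) != 0.
  by move: D1; congr (_ != _); rewrite /cross !planeE; ring.
have na : normal_sq (fun w => det3 w B' C') = dot (C - B) (C - B).
  by rewrite /normal_sq /det3 !absoluteE !planeE !coordE; ring.
have nb : normal_sq (fun w => det3 A' w C') = dot (C - A) (C - A).
  by rewrite /normal_sq /det3 !absoluteE !planeE !coordE; ring.
have nc : normal_sq (fun w => det3 A' B' w) = dot (B - A) (B - A).
  by rewrite /normal_sq /det3 !absoluteE !planeE !coordE; ring.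
have neq X Y Z : cross (Y - X) (Z - X) != 0 -> dot (Y - X) (Y - X) != 0.
  move=> c; apply: lt0r_neq0; apply: dot_gt0 => e; move/eqP: c; apply.
  by rewrite e /cross /abscissa /ordinate !mxE; ring.
have a0 := neq _ _ _ D2; have c0 := neq _ _ _ D1.
have b0 : dot (C - A) (C - A) != 0.
  by have := neq _ _ _ D3; congr (_ != _); rewrite !planeE; ring.
have E1 (w : 'rV[R]_(2 + 1)) : cross (B - A) (from_origin w A) = det3 A' B' w.
  by rewrite /cross /det3 abscissa_from ordinate_from !planeE !coordE; ring.
have E2 (w : 'rV[R]_(2 + 1)) : cross (C - A) (from_origin w A) = - det3 A' w C'.
  by rewrite /cross /det3 abscissa_from ordinate_from !planeE !coordE; ring.
have E3 (w : 'rV[R]_(2 + 1)) : cross (C - B) (from_origin w B) = det3 w B' C'.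
  by rewrite /cross /det3 abscissa_from ordinate_from !planeE !coordE; ring.
have E4 (w : 'rV[R]_(2 + 1)) : cross (A - B) (from_origin w B) = - det3 A' B' w.
  by rewrite /cross /det3 abscissa_from ordinate_from !planeE !coordE; ring.
have E5 (w : 'rV[R]_(2 + 1)) : cross (A - C) (from_origin w C) = det3 A' w C'.
  by rewrite /cross /det3 abscissa_from ordinate_from !planeE !coordE; ring.
have E6 (w : 'rV[R]_(2 + 1)) : cross (B - C) (from_origin w C) = - det3 w B' C'.
  by rewrite /cross /det3 abscissa_from ordinate_from !planeE !coordE; ring.
have EP X : P - X = from_origin P' X.
  by apply: eq_plane; rewrite ?abscissa_from ?ordinate_from !planeE !coordE mul1r.
have dotN X Y : dot (X - Y) (X - Y) = dot (Y - X) (Y - X).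
  by rewrite !planeE; ring.
rewrite na nb nc.
have body : P <> A -> P <> B -> P <> C ->
  [/\ reflected_cevian A B C P v, reflected_cevian B C A P v &
           reflected_cevian C A B P v] <-> exists k,
    [/\ det3 P' B' C' * det3 v B' C' = k * dot (C - B) (C - B),
        det3 A' P' C' * det3 A' v C' = k * dot (C - A) (C - A) &
        det3 A' B' P' * det3 A' B' v = k * dot (B - A) (B - A)].
  move=> PA PB PC; split.
    move=> [] /(reflected_cevianP v D1 PA) h1 /(reflected_cevianP v D2 PB) h2 _.
    move: h1 h2; rewrite !EP E1 E1 E2 E2 E3 E3 E4 E4 (dotN A B) => h1 h2.
    exists (det3 A' B' P' * det3 A' B' v / dot (B - A) (B - A)); split.
    - apply: (mulfI c0); apply/eqP; rewrite -subr_eq0; apply/eqP.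
      move/eqP: h2; rewrite -subr_eq0 => /eqP h2.
      by rewrite -[RHS]h2; field.
    - apply: (mulfI c0); apply/eqP; rewrite -subr_eq0; apply/eqP.
      move/eqP: h1; rewrite -subr_eq0 => /eqP h1.
      by rewrite -[RHS]oppr0 -h1; field.
    - by rewrite mulfVK.
  move=> [k [h1 h2 h3]]; split.
  - apply/(reflected_cevianP v D1 PA); rewrite !EP !E1 !E2 h3 mulrNN h2; ring.
  - apply/(reflected_cevianP v D2 PB); rewrite !EP !E3 !E4 h1 mulrNN h3 dotN; ring.
  - apply/(reflected_cevianP v D3 PC); rewrite !EP !E5 !E6 h2 mulrNN h1.
    by rewrite (dotN B C) (dotN A C); ring.
split; first by move=> [[PA PB PC] v0 /(body PA PB PC)].
by move=> [[PA PB PC] v0 /(body PA PB PC)].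
Qed.

End Isogonal.

Section Determinant.
Variable R : realType.
Local Notation hat := affine_point.

Lemma linear_form_det3 (y z : 'rV[R]_(2 + 1)) : linear_form (fun v => det3 v y z).
Proof.
apply: linear_formD; last (apply: linear_formZr; exact: linear_form_cw).
apply: linear_formD; first (apply: linear_formZr; exact: linear_form_cx).
by apply: linear_formN; (apply: linear_formZr; exact: linear_form_cy).
Qed.

Lemma det3_rot (x y z : 'rV[R]_(2 + 1)) : det3 x y z = det3 y z x.
Proof. by rewrite /det3; ring. Qed.

Lemma cramer3 (x y z v : 'rV[R]_(2 + 1)) : det3 x y z != 0 ->
  v = (det3 v y z / det3 x y z) *: x + (det3 x v z / det3 x y z) *: y
    + (det3 x y v / det3 x y z) *: z.
Proof.
move=> D0; apply: eq_space; rewrite !coordE; apply: (mulIf D0).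
- transitivity (det3 v y z * cx x + det3 x v z * cx y + det3 x y v * cx z).
    by rewrite /det3; ring.
  by field.
- transitivity (det3 v y z * cy x + det3 x v z * cy y + det3 x y v * cy z).
    by rewrite /det3; ring.
  by field.
- transitivity (det3 v y z * cw x + det3 x v z * cw y + det3 x y v * cw z).
    by rewrite /det3; ring.
  by field.
Qed.

Lemma triangle_det3 (A B C : 'rV[R]_2) :
  triangle A B C -> det3 (hat A) (hat B) (hat C) != 0.
Proof.
move=> [AB nl]; apply/eqP => D0; apply: nl.
have dB : B - A <> 0 by move=> /eqP; rewrite subr_eq0 => /eqP /esym.
have dd := lt0r_neq0 (dot_gt0 dB).
have c0 : cross (B - A) (C - A) = 0.
  by rewrite -[RHS]D0 /cross /det3 !planeE !coordE; ring.
exists (dot (C - A) (B - A) / dot (B - A) (B - A)).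
apply/eqP; rewrite -subr_eq0; apply/eqP; apply: eq_plane.
  apply: (mulfI dd); transitivity (- ordinate (B - A) * cross (B - A) (C - A)).
    rewrite abscissaD abscissaN abscissaD abscissaZ.
    transitivity (dot (B - A) (B - A) * (abscissa C - abscissa A)
      - dot (C - A) (B - A) * abscissa (B - A)); first by field.
    by rewrite /cross !planeE; ring.
  by rewrite c0 /abscissa !mxE !mulr0.
apply: (mulfI dd); transitivity (abscissa (B - A) * cross (B - A) (C - A)).
  rewrite ordinateD ordinateN ordinateD ordinateZ.
  transitivity (dot (B - A) (B - A) * (ordinate C - ordinate A)
    - dot (C - A) (B - A) * ordinate (B - A)); first by field.
  by rewrite /cross !planeE; ring.
by rewrite c0 /ordinate !mxE !mulr0.
Qed.

Lemma det3_neq (A B C : 'rV[R]_2) : det3 (hat A) (hat B) (hat C) != 0 ->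
  [/\ A <> B, B <> C & C <> A].
Proof.
move=> D0; split=> e; move/eqP: D0; apply; rewrite e /det3 !coordE; ring.
Qed.

Lemma normal_sq_gt0 (B C : 'rV[R]_2) : B <> C ->
  0 < normal_sq (fun w => det3 w (hat B) (hat C)).
Proof.
move=> BC; have d0 : C - B <> 0 by move=> /eqP; rewrite subr_eq0 => /eqP /esym.
have := dot_gt0 d0; congr (_ < _).
by rewrite /normal_sq /det3 !absoluteE !planeE !coordE; ring.
Qed.

End Determinant.

(** * Chords of the outer ellipse tangent to the caustic *)

Section Ellipses.
Variable R : realType.
Variables (a b : R) (O u : 'rV[R]_2) (p q : R).
Hypotheses (a0 : 0 < a) (b0 : 0 < b) (p0 : 0 < p) (q0 : 0 < q) (u1 : dot u u = 1).
Hypothesis nested : ellipse_at O u p q `<=` ellipse_interior a b.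
Implicit Types (A B C X Y : 'rV[R]_2) (v w : 'rV[R]_(2 + 1)).

Definition ellipse_form v w : R :=
  cx v * cx w / a ^+ 2 + cy v * cy w / b ^+ 2 - cw v * cw w.

(** Coordinates in which the caustic is the unit circle. *)
Definition long_coord v : R :=
  ((cx v - cw v * abscissa O) * abscissa u
   + (cy v - cw v * ordinate O) * ordinate u) / p.
Definition short_coord v : R :=
  ((cy v - cw v * ordinate O) * abscissa u
   - (cx v - cw v * abscissa O) * ordinate u) / q.
Definition caustic_form v w : R :=
  long_coord v * long_coord w + short_coord v * short_coord w - cw v * cw w.

Local Notation hat := affine_point.

Lemma ellipseE X : ellipse a b X <-> ellipse_form (hat X) (hat X) = 0.
Proof.
rewrite /ellipse /ellipse_form !coordE /=; split=> [e|e].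
  by apply/eqP; rewrite mulr1 subr_eq0 -e !expr_div_n !expr2.
by apply/eqP; rewrite -subr_eq0 -e; apply/eqP; field; rewrite !gt_eqF.
Qed.

Lemma ellipse_interiorE X :
  ellipse_interior a b X <-> ellipse_form (hat X) (hat X) < 0.
Proof.
rewrite /ellipse_interior /ellipse_form !coordE /= -subr_lt0.
suff -> : (abscissa X / a) ^+ 2 + (ordinate X / b) ^+ 2 - 1 =
  abscissa X * abscissa X / a ^+ 2 + ordinate X * ordinate X / b ^+ 2 - 1 * 1 by [].
by rewrite mulr1 !expr_div_n !expr2.
Qed.

Lemma ellipse_atE X :
  ellipse_at O u p q X <-> caustic_form (hat X) (hat X) = 0.
Proof.
have -> : caustic_form (hat X) (hat X) =
    (dot (X - O) u / p) ^+ 2 + (dot (X - O) (perp u) / q) ^+ 2 - 1.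
  rewrite /caustic_form /long_coord /short_coord !coordE !planeE.
  by field; rewrite !gt_eqF.
by rewrite /ellipse_at /=; split=> /eqP e; apply/eqP; rewrite ?subr_eq0 // -subr_eq0.
Qed.

(** Strict convexity of the ellipse. *)
Lemma ellipse_form_lt0 X Y : ellipse a b X -> ellipse a b Y -> X <> Y ->
  ellipse_form (hat X) (hat Y) < 0.
Proof.
move=> /ellipseE eX /ellipseE eY XY.
have : 0 < ((abscissa X - abscissa Y) / a) ^+ 2
    + ((ordinate X - ordinate Y) / b) ^+ 2.
  rewrite lt0r addr_ge0 ?sqr_ge0 // andbT paddr_eq0 ?sqr_ge0 // !sqrf_eq0.
  rewrite !mulf_eq0 !invr_eq0 (gt_eqF a0) (gt_eqF b0) !orbF !subr_eq0.
  by apply/negP => /andP[/eqP h1 /eqP h2]; apply: XY; apply: eq_plane.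
have -> : ((abscissa X - abscissa Y) / a) ^+ 2
    + ((ordinate X - ordinate Y) / b) ^+ 2 =
  ellipse_form (hat X) (hat X) + ellipse_form (hat Y) (hat Y)
   - 2 * ellipse_form (hat X) (hat Y).
  by rewrite /ellipse_form !coordE; field; rewrite !gt_eqF.
by rewrite eX eY; lra.
Qed.

(** On the chord the caustic form is a quadratic polynomial in the parameter
    [t], with a positive leading coefficient [L], and tangency makes its root
    [t] double. The point of contact is inside the outer ellipse, so [0 < t <
    1], and the values at [A] and [B] are [t ^+ 2 * L] and [(1 - t) ^+ 2 * L]
    while the mixed value is [- (t * (1 - t) * L)]. *)
Lemma tangent_chord A B : ellipse a b A -> ellipse a b B -> A <> B ->
  tangent A B (ellipse_at O u p q) ->
  [/\ caustic_form (hat A) (hat B) ^+ 2 =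
      caustic_form (hat A) (hat A) * caustic_form (hat B) (hat B),
      caustic_form (hat A) (hat B) < 0 & 0 < caustic_form (hat A) (hat A)].
Proof.
move=> EA EB AB [X [[[t Xt] KX] uniqX]].
set mAB := caustic_form (hat A) (hat B); set AA := caustic_form (hat A) _.
set BB := caustic_form (hat B) _.
pose L := AA - 2 * mAB + BB.
have onAB s : caustic_form (hat (A + s *: (B - A))) (hat (A + s *: (B - A))) =
    AA + 2 * s * (mAB - AA) + s ^+ 2 * L.
  rewrite /L /AA /mAB /BB /caustic_form /long_coord /short_coord !coordE !planeE.
  by field; rewrite !gt_eqF.
have L0 : 0 < L.
  have dB : B - A <> 0 by move=> /eqP; rewrite subr_eq0 => /eqP /esym.
  have LE : L = (dot (B - A) u / p) ^+ 2 + (cross u (B - A) / q) ^+ 2.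
    rewrite /L /AA /mAB /BB /caustic_form /long_coord /short_coord /cross !coordE !planeE.
    by field; rewrite !gt_eqF.
  rewrite LE lt0r addr_ge0 ?sqr_ge0 // andbT paddr_eq0 ?sqr_ge0 // !sqrf_eq0.
  rewrite !mulf_eq0 !invr_eq0 (gt_eqF p0) (gt_eqF q0) !orbF.
  apply/negP => /andP[/eqP h1 /eqP h2]; have /lt0r_neq0/eqP := dot_gt0 dB; apply.
  rewrite -[LHS]mul1r -u1.
  transitivity (dot (B - A) u ^+ 2 + cross u (B - A) ^+ 2).
    by rewrite /cross !planeE; ring.
  by rewrite h1 h2; ring.
have Ln := lt0r_neq0 L0.
have root : AA + 2 * t * (mAB - AA) + t ^+ 2 * L = 0.
  by rewrite -onAB -Xt; apply/ellipse_atE.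
have tE : t * L = AA - mAB.
  pose t' := 2 * (AA - mAB) / L - t.
  have root' : AA + 2 * t' * (mAB - AA) + t' ^+ 2 * L = 0.
    by rewrite -[RHS]root /t'; field.
  have XX : X = A + t' *: (B - A).
    apply: uniqX; split; first by exists t'.
    by apply/ellipse_atE; rewrite onAB.
  have : (t' - t) *: (B - A) = 0.
    by rewrite scalerBl; apply/eqP; rewrite subr_eq0 -(inj_eq (addrI A)) -XX Xt.
  move/eqP; rewrite scaler_eq0 => /orP[|]; last first.
    by rewrite subr_eq0 => /eqP /esym.
  rewrite subr_eq0 => /eqP tt; apply: (mulfI (_ : 2 != 0)); first by rewrite pnatr_eq0.
  by transitivity ((t' + t) * L); [rewrite tt; ring|rewrite /t'; field].
have : ellipse_form (hat X) (hat X) < 0 by apply/ellipse_interiorE; exact: nested.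
have -> : ellipse_form (hat X) (hat X) = (1 - t) ^+ 2 * ellipse_form (hat A) (hat A)
   + t ^+ 2 * ellipse_form (hat B) (hat B)
   + 2 * (t * (1 - t)) * ellipse_form (hat A) (hat B).
  by rewrite Xt /ellipse_form !coordE !planeE; field; rewrite !gt_eqF.
have /ellipseE -> := EA; have /ellipseE -> := EB.
rewrite !mulr0 !add0r => neg.
have eAB := ellipse_form_lt0 EA EB AB.
have t01 : 0 < t * (1 - t).
  rewrite ltNge; apply/negP => h; move: neg; apply/negP; rewrite -leNgt.
  by rewrite mulr_le0 //; lra.
have [t0 t1] : 0 < t /\ t < 1.
  have [h|h] := lerP t 0; first by move: t01; nra.
  by split=> //; move: t01; rewrite pmulr_rgt0 // subr_gt0.
have AAE : AA = t ^+ 2 * L.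
  apply/eqP; rewrite -subr_eq0 -[X in _ == X]root -(opprB AA) -tE.
  by apply/eqP; ring.
have mE : mAB = - (t * (1 - t) * L).
  by transitivity (AA - t * L); [rewrite tE|rewrite AAE]; ring.
have BE : BB = L - AA + 2 * mAB by rewrite /L; ring.
split; first by rewrite BE mE AAE; ring.
- by rewrite mE oppr_lt0 mulr_gt0.
- by rewrite AAE mulr_gt0 // exprn_gt0.
Qed.

End Ellipses.

(** * The self-polar coordinates of a Poncelet triangle *)

Section BaseTriangle.
Variable R : realType.
Variables (a b : R) (O u : 'rV[R]_2) (p q : R).
Hypotheses (a0 : 0 < a) (b0 : 0 < b) (p0 : 0 < p) (q0 : 0 < q) (u1 : dot u u = 1).
Hypothesis nested : ellipse_at O u p q `<=` ellipse_interior a b.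
Hypothesis porism : triangle_porism (ellipse a b) (ellipse_at O u p q).
Local Notation hat := affine_point.
Local Notation E := (ellipse_form a b).
Local Notation m := (caustic_form O u p q).
Local Notation poncelet := (poncelet_triangle (ellipse a b) (ellipse_at O u p q)).

Variables A B C : 'rV[R]_2.
Hypothesis base : poncelet A B C.

Let D := det3 (hat A) (hat B) (hat C).
Let e1 := E (hat B) (hat C).
Let e2 := E (hat C) (hat A).
Let e3 := E (hat A) (hat B).
Let m1 := m (hat B) (hat C).
Let m2 := m (hat C) (hat A).
Let m3 := m (hat A) (hat B).

(** The weights of the form for which the Poncelet triangles are self-polar,
    and coordinates with respect to the lifts of the vertices rescaled by [-
    e1], [- e2], [- e3]; this scaling gives the three terms of the outer
    ellipse the same coefficient. *)
Definition base_f := e1 / m1.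
Definition base_g := e2 / m2.
Definition base_h := e3 / m3.
Definition base_coord1 v := det3 v (hat B) (hat C) * (- (e1 * D)^-1).
Definition base_coord2 v := det3 v (hat C) (hat A) * (- (e2 * D)^-1).
Definition base_coord3 v := det3 v (hat A) (hat B) * (- (e3 * D)^-1).

Local Notation f := base_f.
Local Notation g := base_g.
Local Notation h := base_h.
Local Notation Y1 := base_coord1.
Local Notation Y2 := base_coord2.
Local Notation Y3 := base_coord3.

Lemma base_D : D != 0.
Proof. by case: base => /triangle_det3. Qed.

Lemma base_signs : [/\ e1 < 0, e2 < 0 & e3 < 0] /\ [/\ m1 < 0, m2 < 0 & m3 < 0].
Proof.
have [nAB nBC nCA] := det3_neq base_D.
case: base => _ [EA EB EC] [tBC tCA tAB].
split; first by split; exact: ellipse_form_lt0.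
have [_ ? _] := tangent_chord a0 b0 p0 q0 u1 nested EB EC nBC tBC.
have [_ ? _] := tangent_chord a0 b0 p0 q0 u1 nested EC EA nCA tCA.
by have [_ ? _] := tangent_chord a0 b0 p0 q0 u1 nested EA EB nAB tAB.
Qed.

Lemma base_fgh : [/\ 0 < f, 0 < g & 0 < h].
Proof.
have [[h1 h2 h3] [k1 k2 k3]] := base_signs.
by split; rewrite /base_f /base_g /base_h ltr_ndivlMr // mul0r.
Qed.

(** The caustic touches the three sides, which ties the diagonal entries of
    its matrix to the other ones. *)
Lemma base_caustic : [/\ m (hat A) (hat A) = - (m2 * m3 / m1),
  m (hat B) (hat B) = - (m3 * m1 / m2) & m (hat C) (hat C) = - (m1 * m2 / m3)].
Proof.
have [nAB nBC nCA] := det3_neq base_D.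
have [_ [k1 k2 k3]] := base_signs.
case: base => _ [EA EB EC] [tBC tCA tAB].
have [s1 _ gB] := tangent_chord a0 b0 p0 q0 u1 nested EB EC nBC tBC.
have [s2 _ gC] := tangent_chord a0 b0 p0 q0 u1 nested EC EA nCA tCA.
have [s3 _ gA] := tangent_chord a0 b0 p0 q0 u1 nested EA EB nAB tAB.
rewrite -/m1 in s1; rewrite -/m2 in s2; rewrite -/m3 in s3.
have key (x y z n1 n2 n3 : R) : 0 < x -> 0 < y -> 0 < z ->
    n1 < 0 -> n2 < 0 -> n3 < 0 ->
    n1 ^+ 2 = y * z -> n2 ^+ 2 = z * x -> n3 ^+ 2 = x * y -> x = - (n2 * n3 / n1).
  move=> x0 y0 z0 n10 n20 n30 q1 q2 q3.
  have pos : 0 < - (n2 * n3 / n1).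
    by rewrite oppr_gt0 ltr_ndivrMr // mul0r nmulr_rgt0.
  apply/eqP; rewrite -(@eqrXn2 _ 2) ?ltW //; apply/eqP.
  transitivity (n2 ^+ 2 * n3 ^+ 2 / n1 ^+ 2); last by field; rewrite lt_eqF.
  by rewrite q1 q2 q3; field; rewrite !gt_eqF.
split; first exact: key s1 s2 s3.
  exact: key s2 s3 s1.
exact: key s3 s1 s2.
Qed.

Lemma base_expand v :
  v = (Y1 v * - e1) *: hat A + (Y2 v * - e2) *: hat B + (Y3 v * - e3) *: hat C.
Proof.
have [[h1 h2 h3] _] := base_signs; have D0 := base_D.
rewrite {1}(cramer3 v D0); congr (_ *: _ + _ *: _ + _ *: _);
  rewrite /base_coord1 /base_coord2 /base_coord3 -/D.
- by field; rewrite D0 lt_eqF.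
- have -> : det3 v (hat C) (hat A) = det3 (hat A) v (hat C) by rewrite /det3; ring.
  by field; rewrite D0 lt_eqF.
- by rewrite -det3_rot -det3_rot; field; rewrite D0 lt_eqF.
Qed.

Lemma base_linear : [/\ linear_form Y1, linear_form Y2 & linear_form Y3].
Proof. by split; apply: linear_formZr; exact: linear_form_det3. Qed.

Lemma base_inj v w : Y1 v = Y1 w -> Y2 v = Y2 w -> Y3 v = Y3 w -> v = w.
Proof. by move=> h1 h2 h3; rewrite (base_expand v) (base_expand w) h1 h2 h3. Qed.

Lemma base_surj x1 x2 x3 : exists v, [/\ Y1 v = x1, Y2 v = x2 & Y3 v = x3].
Proof.
have [[h1 h2 h3] _] := base_signs; have D0 := base_D.
exists ((x1 * - e1) *: hat A + (x2 * - e2) *: hat B + (x3 * - e3) *: hat C).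
rewrite /base_coord1 /base_coord2 /base_coord3; split.
- transitivity (x1 * - e1 * D * - (e1 * D)^-1).
    by rewrite /D /det3 !coordE; ring.
  by field; rewrite D0 lt_eqF.
- transitivity (x2 * - e2 * D * - (e2 * D)^-1).
    by rewrite /D /det3 !coordE; ring.
  by field; rewrite D0 lt_eqF.
- transitivity (x3 * - e3 * D * - (e3 * D)^-1).
    by rewrite /D /det3 !coordE; ring.
  by field; rewrite D0 lt_eqF.
Qed.

Lemma base_ellipse_form v w : E v w = e1 * e2 * e3 *
  (Y2 v * Y3 w + Y3 v * Y2 w + (Y3 v * Y1 w + Y1 v * Y3 w)
   + (Y1 v * Y2 w + Y2 v * Y1 w)).
Proof.
have bil x1 x2 x3 y1 y2 y3 :
    E (x1 *: hat A + x2 *: hat B + x3 *: hat C) (y1 *: hat A + y2 *: hat B + y3 *: hat C)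
    = x1 * y1 * E (hat A) (hat A) + x2 * y2 * E (hat B) (hat B)
    + x3 * y3 * E (hat C) (hat C) + e1 * (x2 * y3 + x3 * y2)
    + e2 * (x3 * y1 + x1 * y3) + e3 * (x1 * y2 + x2 * y1).
  by rewrite /e1 /e2 /e3 /ellipse_form !coordE; field; rewrite !gt_eqF.
case: base => _ [/(ellipseE a0 b0) EA /(ellipseE a0 b0) EB /(ellipseE a0 b0) EC] _.
rewrite {1}(base_expand v) {1}(base_expand w) bil EA EB EC; ring.
Qed.

Lemma base_cone v : E v v = 0 <-> cone Y1 Y2 Y3 v.
Proof.
have [[h1 h2 h3] _] := base_signs.
have k0 : 2 * (e1 * e2 * e3) != 0.
  by rewrite !mulf_neq0 ?pnatr_eq0 // lt_eqF.
rewrite base_ellipse_form /cone; split=> e.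
  by apply: (mulfI k0); rewrite mulr0 -e; ring.
by transitivity (2 * (e1 * e2 * e3) * 0); [rewrite -e; ring|rewrite mulr0].
Qed.

Lemma base_caustic_form v w : m v w = - (e1 * e2 * e3) / (f * g * h) *
  (f ^+ 2 * Y1 v * Y1 w + g ^+ 2 * Y2 v * Y2 w + h ^+ 2 * Y3 v * Y3 w
    - g * h * (Y2 v * Y3 w + Y3 v * Y2 w) - h * f * (Y3 v * Y1 w + Y1 v * Y3 w)
    - f * g * (Y1 v * Y2 w + Y2 v * Y1 w)).
Proof.
have bil x1 x2 x3 y1 y2 y3 :
    m (x1 *: hat A + x2 *: hat B + x3 *: hat C) (y1 *: hat A + y2 *: hat B + y3 *: hat C)
    = x1 * y1 * m (hat A) (hat A) + x2 * y2 * m (hat B) (hat B)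
    + x3 * y3 * m (hat C) (hat C) + m1 * (x2 * y3 + x3 * y2)
    + m2 * (x3 * y1 + x1 * y3) + m3 * (x1 * y2 + x2 * y1).
  rewrite /m1 /m2 /m3 /caustic_form /long_coord /short_coord !coordE.
  by field; rewrite !gt_eqF.
have [mA mB mC] := base_caustic.
have [[h1 h2 h3] [k1 k2 k3]] := base_signs.
rewrite {1}(base_expand v) {1}(base_expand w) bil mA mB mC /base_f /base_g /base_h.
rewrite -/e1 -/e2 -/e3 -/m1 -/m2 -/m3.
by field; rewrite !lt_eqF.
Qed.

(** The factor of [chord_polar_identity] other than [polar] is proportional to
    the mixed value of the form of the outer ellipse, nonzero by strict
    convexity. *)
Lemma tangent_polar (X Y : 'rV[R]_2) : ellipse a b X -> ellipse a b Y -> X <> Y ->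
  tangent X Y (ellipse_at O u p q) -> polar f g h Y1 Y2 Y3 (hat X) (hat Y) = 0.
Proof.
move=> EX EY XY tXY.
have [e _ _] := tangent_chord a0 b0 p0 q0 u1 nested EX EY XY tXY.
have [[h1 h2 h3] _] := base_signs; have [f0 g0 h0] := base_fgh.
have cX : cone Y1 Y2 Y3 (hat X) by apply/base_cone/(ellipseE a0 b0).
have cY : cone Y1 Y2 Y3 (hat Y) by apply/base_cone/(ellipseE a0 b0).
have := chord_polar_identity f g h cX cY; rewrite /= => id.
have := ellipse_form_lt0 a0 b0 EX EY XY; rewrite base_ellipse_form => neg.
have n2 : f * g * h != 0.
  exact: mulf_neq0 (mulf_neq0 (lt0r_neq0 f0) (lt0r_neq0 g0)) (lt0r_neq0 h0).
have k0 : - (e1 * e2 * e3) / (f * g * h) != 0.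
  have n1 : e1 * e2 * e3 != 0 by rewrite !mulf_neq0 // lt_eqF.
  by rewrite mulf_neq0 ?oppr_eq0 ?invr_eq0.
move: e id; rewrite !base_caustic_form.
set k := _ / _ in k0 *.
set XX := (X in _ = k * X * _); set YY := (X in _ = _ * (k * X)).
set XY' := (X in (k * X) ^+ 2 = _) => e.
have -> : XX * YY - XY' ^+ 2 = 0.
  apply: (mulfI (mulf_neq0 k0 k0)); rewrite mulr0.
  transitivity (k * XX * (k * YY) - (k * XY') ^+ 2); first by ring.
  by rewrite e subrr.
move/esym => z; rewrite /polar /polar_form.
apply: (mulfI (_ : 4 * (f * g * h) != 0)).
  by rewrite mulf_neq0 ?pnatr_eq0.
move: neg; set T := (X in e1 * e2 * e3 * X) => neg.
have T0 : T != 0 by apply/eqP => T0; move: neg; rewrite T0 mulr0 ltxx.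
by apply: (mulIf T0); rewrite mulr0 mul0r -[RHS]z.
Qed.

Local Notation pol := (polar f g h Y1 Y2 Y3).

Definition triangle_lifts :
  set ('rV[R]_(2 + 1) * 'rV[R]_(2 + 1) * 'rV[R]_(2 + 1)) :=
  [set T | exists X Y Z, poncelet X Y Z /\ T = (hat X, hat Y, hat Z)].

Lemma hat_neq0 (X : 'rV[R]_2) : hat X <> 0.
Proof. by move=> /(congr1 (@cw R)) /eqP; rewrite !coordE oner_eq0. Qed.

Lemma poncelet_polar_frame X Y Z : poncelet X Y Z ->
  polar_frame f g h Y1 Y2 Y3 (hat X) (hat Y) (hat Z).
Proof.
move=> [tri [EX EY EZ] [tYZ tZX tXY]].
have [nXY nYZ nZX] := det3_neq (triangle_det3 tri).
split; first by split; exact: hat_neq0.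
- by split; apply/base_cone/(ellipseE a0 b0).
- by split; exact: tangent_polar.
Qed.

Lemma triangle_lifts_frame X Y Z : triangle_lifts (X, Y, Z) ->
  polar_frame f g h Y1 Y2 Y3 X Y Z.
Proof. by move=> [X' [Y' [Z' [pon [-> -> ->]]]]]; exact: poncelet_polar_frame. Qed.

Lemma triangle_lifts_vertex X : X <> 0 -> cone Y1 Y2 Y3 X ->
  exists (c : R) Y Z, c != 0 /\ triangle_lifts (c *: X, Y, Z).
Proof.
move=> X0 /base_cone EX.
have w0 : cw X != 0.
  apply/eqP => w0; apply: X0; move: EX.
  have -> : E X X = (cx X / a) ^+ 2 + (cy X / b) ^+ 2.
    by rewrite /ellipse_form w0; field; rewrite !gt_eqF.
  move/eqP; rewrite paddr_eq0 ?sqr_ge0 // !sqrf_eq0 !mulf_eq0 !invr_eq0.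
  rewrite (gt_eqF a0) (gt_eqF b0) !orbF => /andP[/eqP hx /eqP hy].
  by apply: eq_space; rewrite !coordE.
pose X' : 'rV[R]_2 := (cw X)^-1 *: \row_(j < 2) (if j == 0 then cx X else cy X).
have XE : (cw X)^-1 *: X = hat X'.
  apply: eq_space; rewrite !coordE ?mulVf //.
    by rewrite abscissaZ /abscissa mxE.
  by rewrite ordinateZ /ordinate mxE.
have EX' : ellipse a b X'.
  apply/(ellipseE a0 b0); rewrite -XE.
  transitivity ((cw X)^-1 ^+ 2 * E X X); last by rewrite EX mulr0.
  by rewrite /ellipse_form !coordE; ring.
have [Y [Z pon]] := porism EX'.
exists (cw X)^-1, (hat Y), (hat Z); rewrite invr_eq0; split=> //.
by exists X', Y, Z; rewrite XE.
Qed.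

(** By orthogonality the form [pol X] is a multiple of the equation of the
    side opposite to [X], and the conditions of [isogonal_conjugateP] are
    homogeneous in these equations. *)
Lemma isogonal_confocal X Y Z (P : 'rV[R]_2) v : poncelet X Y Z ->
  isogonal_conjugate X Y Z P v <->
  [/\ [/\ P <> X, P <> Y & P <> Z], v <> 0 & exists k,
    [/\ pol (hat X) (hat P) * pol (hat X) v = k * normal_sq (pol (hat X)),
        pol (hat Y) (hat P) * pol (hat Y) v = k * normal_sq (pol (hat Y)) &
        pol (hat Z) (hat P) * pol (hat Z) v = k * normal_sq (pol (hat Z))]].
Proof.
move=> pon; have D0 : det3 (hat X) (hat Y) (hat Z) != 0.
  by case: pon => /triangle_det3.
have [[Xn Yn Zn] _ [oXY oYZ oZX]] := poncelet_polar_frame pon.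
have [f0 g0 h0] := base_fgh; have [l1 l2 l3] := base_linear.
have pos W : W <> 0 -> pol W W != 0.
  move=> Wn; apply: lt0r_neq0; apply: polar_gt0 => //; exact: base_inj.
have [pX pY pZ] := And3 (pos _ Xn) (pos _ Yn) (pos _ Zn).
have add x v1 v2 : pol x (v1 + v2) = pol x v1 + pol x v2 by exact: polarD.
have scl x c w : pol x (c *: w) = c * pol x w by exact: polarZ.
set D1 := det3 _ _ _ in D0.
have EX w : pol (hat X) w = pol (hat X) (hat X) / D1 * det3 w (hat Y) (hat Z).
  rewrite {1}(cramer3 w D0) !(add, scl) oXY (polarC _ _ _ _ _ _ (hat X) (hat Z)) oZX.
  by rewrite -/D1; ring.
have EY w : pol (hat Y) w = pol (hat Y) (hat Y) / D1 * det3 (hat X) w (hat Z).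
  rewrite {1}(cramer3 w D0) !(add, scl) oYZ (polarC _ _ _ _ _ _ (hat Y) (hat X)) oXY.
  by rewrite -/D1; ring.
have EZ w : pol (hat Z) w = pol (hat Z) (hat Z) / D1 * det3 (hat X) (hat Y) w.
  rewrite {1}(cramer3 w D0) !(add, scl) oZX (polarC _ _ _ _ _ _ (hat Z) (hat Y)) oYZ.
  by rewrite -/D1; ring.
rewrite (isogonal_conjugateP P v D0).
have side (phi l : 'rV[R]_(2 + 1) -> R) c k :
    c != 0 -> (forall w, phi w = c * l w) ->
    (phi (hat P) * phi v = k * normal_sq phi) <->
    (l (hat P) * l v = k * normal_sq l).
  move=> c0 phiE; rewrite /normal_sq !phiE; split=> e; last first.
    transitivity (c ^+ 2 * (l (hat P) * l v)); first by ring.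
    by rewrite e /normal_sq; ring.
  apply: (mulfI (_ : c ^+ 2 != 0)); first by rewrite expf_eq0.
  by transitivity (c * l (hat P) * (c * l v)); [ring|rewrite e; ring].
have sX k := side _ _ _ k (mulf_neq0 pX (invr_neq0 D0)) EX.
have sY k := side _ _ _ k (mulf_neq0 pY (invr_neq0 D0)) EY.
have sZ k := side _ _ _ k (mulf_neq0 pZ (invr_neq0 D0)) EZ.
by split=> -[neq v0 [k [h1 h2 h3]]]; split=> //; exists k; split;
  [apply/sX|apply/sY|apply/sZ|apply/sX|apply/sY|apply/sZ].
Qed.

Lemma base_normal : [/\ 0 < normal_sq Y1, 0 < normal_sq Y2 & 0 < normal_sq Y3].
Proof.
have [[h1 h2 h3] _] := base_signs; have D0 := base_D.
have [nAB nBC nCA] := det3_neq D0.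
have pos (X Y : 'rV[R]_2) k : X <> Y -> k != 0 ->
    0 < normal_sq (fun v => det3 v (hat X) (hat Y) * k).
  move=> XY k0; have -> : normal_sq (fun v => det3 v (hat X) (hat Y) * k) =
    normal_sq (fun v => det3 v (hat X) (hat Y)) * k ^+ 2 by rewrite /normal_sq; ring.
  by rewrite mulr_gt0 ?normal_sq_gt0 // exprn_even_gt0.
split; apply: pos => //; rewrite oppr_eq0 invr_eq0 mulf_neq0 // lt_eqF //.
Qed.

Lemma isogonal_locusE P :
  isogonal_locus (ellipse a b) (ellipse_at O u p q) P =
  frame_locus f g h Y1 Y2 Y3 triangle_lifts (hat P) (absolute_x R) (absolute_y R).
Proof.
have [f0 g0 h0] := base_fgh; have [l1 l2 l3] := base_linear.
have [n1 n2 n3] := base_normal.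
have hatP X : P <> X <-> forall c, hat P <> c *: hat X.
  split=> [PX c /affine_point_inj //|nc PX].
  by apply: (nc 1); rewrite scale1r PX.
apply/seteqP; split=> v.
  move=> [X [Y [Z [pon /(isogonal_confocal P v pon)[[PX PY PZ] v0 iso]]]]].
  split=> //; exists (hat X), (hat Y), (hat Z); split.
  - by exists X, Y, Z.
  - by split; apply/hatP.
  - have fr := poncelet_polar_frame pon.
    by have /(confocal_iff_proportional f0 g0 h0 l1 l2 l3 base_inj (hat P) n1 n2 n3 v fr)
      [? [? ?]] := iso.
move=> [v0 [_ [_ [_ [[X [Y [Z [pon [-> -> ->]]]]] [PX PY PZ] [cX cY cZ]]]]]].
exists X, Y, Z; split=> //; apply/(isogonal_confocal P v pon); split=> //.
  by split; apply/hatP.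
have fr := poncelet_polar_frame pon.
exact/(confocal_iff_proportional f0 g0 h0 l1 l2 l3 base_inj (hat P) n1 n2 n3 v fr).
Qed.

Lemma isogonal_locus_conic P : P = A \/ ~ ellipse a b P ->
  is_conic (isogonal_locus (ellipse a b) (ellipse_at O u p q) P).
Proof.
have [f0 g0 h0] := base_fgh; have [l1 l2 l3] := base_linear.
have [n1 n2 n3] := base_normal.
rewrite isogonal_locusE => -[->|nP].
  apply: frame_locus_at_vertex => //; [exact: base_inj|exact: base_surj
    |exact: triangle_lifts_frame|exact: triangle_lifts_vertex|exact: hat_neq0| |].
  - by rewrite /base_coord2 /det3; ring.
  - by rewrite /base_coord3 /det3; ring.
apply: frame_locus_off_cone => //; [exact: base_inj|exact: base_surj
  |exact: triangle_lifts_frame|exact: triangle_lifts_vertex|].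
by move=> /base_cone /(ellipseE a0 b0).
Qed.

End BaseTriangle.

Theorem theorem4 (R : realType) (a b : R) (O u : 'rV[R]_2) (p q : R)
    (P : 'rV[R]_2)
    (ha : 0 < a) (hb : 0 < b) (hp : 0 < p) (hq : 0 < q) (hu : dot u u = 1)
    (hnested : ellipse_at O u p q `<=` ellipse_interior a b)
    (hporism : triangle_porism (ellipse a b) (ellipse_at O u p q)) :
  is_conic (isogonal_locus (ellipse a b) (ellipse_at O u p q) P).
Proof.
have [EP|nEP] := boolp.EM (ellipse a b P).
  have [B [C pon]] := hporism P EP.
  by apply: (isogonal_locus_conic ha hb hp hq hu hnested hporism pon); left.
have EA : ellipse a b (\row_(j < 2) (if j == 0 then a else 0)).
  rewrite /ellipse /= /abscissa /ordinate !mxE /= divff ?gt_eqF //.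
  by rewrite mul0r expr1n expr0n addr0.
have [B [C pon]] := hporism _ EA.
by apply: (isogonal_locus_conic ha hb hp hq hu hnested hporism pon); right.
Qed.
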